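(* Let $L$ and $N$ be arbitrary positive integers. With the algebras $C_q(N,L)$, $T_q(N,L)$, the elements $\eta(x,y)\in T_q(N,L)$ and the automorphisms $\kappa_\pm$, $\tilde\kappa_\pm$ described in the context, there exists an algebra homomorphism $$\iota\colon C_q(N,L)\to T_q(N,L),\qquad \iota(\chi_i(n))=-\eta(n+i,i),$$ such that $\iota\circ\kappa_+=\tilde\kappa_+\circ\iota$ and $\iota\circ\kappa_-=\tilde\kappa_-\circ\iota$.
   Context: For a positive integer $m$ and an integer $n$, $[n]_m\in\{0,\dots,m-1\}$ is the residue of $n$ modulo $m$, $\delta_m(n)=1$ if $[n]_m=0$ and $0$ otherwise, and $\varepsilon_m(n)=\frac{m-1-2[n]_m}{m}$. Let $F=\gcd(L,N)$, $J=LN/F$, $q\ne0$ a complex number, $h=\ln q$, and $q^s=e^{hs}$. Algebra $C_q(N,L)$: generated by invertible elements $\chi_i(n)$, $i$ modulo $N$, $n$ modulo $2L$, with $\chi_i(n)\chi_j(m)=\chi_j(m)\chi_i(n)$ if $n-m$ is even, and $\chi_i(n)\chi_j(m)=q^{\Omega(i-j,(n-m-1)/2)}\chi_j(m)\chi_i(n)$ if $n$ is even and $m$ is odd, where $\Omega(i,n)=2\delta_L(n)(\delta_N(i)-\delta_N(i+1))+2\delta_L(n+1)(\delta_N(i)-\delta_N(i-1))$. The automorphisms $\kappa_\pm$ are $$\kappa_\pm(\chi_i(n\mp1))=\chi_i(n)\quad(n\text{ even}),$$ $$\kappa_\pm(\chi_i(n\mp1))=q^{-2}\,\frac{1-\chi_{i-1}(n+1)}{1-q^{-2}\chi_i^{-1}(n+1)}\;\frac{1-\chi_{i+1}(n-1)}{1-q^{-2}\chi_i^{-1}(n-1)}\;\chi_i^{-1}(n)\quad(n\text{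 odd}).$$ Algebra $T_q(N,L)$: for integers $x,y$ with $x+y$ odd put $$G(x,y)=\frac12\sum_{j=1}^{N/F}\left(\frac{x-y}{J}+\varepsilon_J\!\left(\frac{x-y-1}{2}+jL\right)\right)\left(\frac{x+y}{N}+\varepsilon_N\!\left(\frac{x+y-1}{2}+jL\right)\right).$$ $T_q(N,L)$ is generated by invertible elements $\tau(x,y)$, $x,y\in\mathbb Z$, with $\tau(x,y)\tau(x',y')=\tau(x',y')\tau(x,y)$ if $x+y$ and $x'+y'$ have the same parity, and $\tau(x,y)\tau(x',y')=q^{G(x-x',y-y')}\tau(x',y')\tau(x,y)$ if $x+y$ is even and $x'+y'$ is odd. Put $\eta(x,y)=(\tau(x-1,y)\tau(x+1,y))^{-1}\tau(x,y-1)\tau(x,y+1)$; the elements $\eta(x+2L,y)\eta(x,y)^{-1}$ and $\eta(x+N,y+N)\eta(x,y)^{-1}$ are central, and the periodicity conditions $\eta(x+2L,y)=\eta(x+N,y+N)=\eta(x,y)$ are imposed. The automorphisms $\tilde\kappa_\pm$ are $$\tilde\kappa_\pm(\tau(x\mp1,y))=\tau(x,y)\quad(x+y\text{ even}),$$ $$\tilde\kappa_\pm(\tau(x\mp1,y))=-\bigl(\tau(x+1,y)\tau(x-1,y)+\tau(x,y+1)\tau(x,y-1)\bigr)\tau^{-1}(x,y)\quad(x+y\text{ odd}).$$ Inverses of non-monomial elements are understood in suitable completions of the algebras.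
   Formalization: The parities ''x+y even'' and ''x+y odd'' are exchanged in the q^G relation of T_q and in the formulas for κ̃±, since as printed ι would give q^{-Ω}; and the intertwining with κ± is claimed only for N, L ≥ 2, since the displayed κ± formulas fail for N=1 or L=1 at generic q. *)

(* Defs.v *)
Set Warnings "-notation-overridden,-ambiguous-paths,-redundant-canonical-projection".
From HB Require Import structures.
From mathcomp Require Import all_boot all_order all_algebra.
From mathcomp Require Import generic_quotient.
From mathcomp Require Import boolp classical_sets reals sequences trigo.
From mathcomp Require Import complex.

Set Implicit Arguments.
Unset Strict Implicit.
Unset Printing Implicit Defensive.

Import GRing.Theory.
Local Open Scope ring_scope.

(* The unital associative K-algebra presented by generators X and relations r:
   formal terms modulo the least congruence containing r and the algebra
   axioms. Nothing excludes 1 = 0, hence the pzRing and lmodule structures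
   below rather than an algType. *)
Section Presentation.
Variables (K : fieldType) (X : Type).

Inductive fterm : Type :=
| FVar of X
| FZero
| FOne
| FOpp of fterm
| FAdd of fterm & fterm
| FMul of fterm & fterm
| FScale of K & fterm.

HB.instance Definition _ := gen_eqMixin fterm.
HB.instance Definition _ := gen_choiceMixin fterm.

Variable r : fterm -> fterm -> Prop.

Inductive pcong : fterm -> fterm -> Prop :=
| PC_rel s t : r s t -> pcong s t
| PC_refl s : pcong s s
| PC_sym s t : pcong s t -> pcong t s
| PC_trans s t u : pcong s t -> pcong t u -> pcong s u
| PC_opp s s' : pcong s s' -> pcong (FOpp s) (FOpp s')
| PC_add s s' t t' : pcong s s' -> pcong t t' -> pcong (FAdd s t) (FAdd s' t')
| PC_mul s s' t t' : pcong s s' -> pcong t t' -> pcong (FMul s t) (FMul s' t')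
| PC_scale k s s' : pcong s s' -> pcong (FScale k s) (FScale k s')
| PC_addA s t u : pcong (FAdd s (FAdd t u)) (FAdd (FAdd s t) u)
| PC_addC s t : pcong (FAdd s t) (FAdd t s)
| PC_add0 s : pcong (FAdd FZero s) s
| PC_addN s : pcong (FAdd (FOpp s) s) FZero
| PC_mulA s t u : pcong (FMul s (FMul t u)) (FMul (FMul s t) u)
| PC_mul1l s : pcong (FMul FOne s) s
| PC_mul1r s : pcong (FMul s FOne) s
| PC_mulDl s t u : pcong (FMul (FAdd s t) u) (FAdd (FMul s u) (FMul t u))
| PC_mulDr s t u : pcong (FMul s (FAdd t u)) (FAdd (FMul s t) (FMul s u))
| PC_scaleA a b s : pcong (FScale a (FScale b s)) (FScale (a * b) s)
| PC_scale1 s : pcong (FScale 1 s) s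
| PC_scaleDr a s t : pcong (FScale a (FAdd s t)) (FAdd (FScale a s) (FScale a t))
| PC_scaleDl a b s : pcong (FScale (a + b) s) (FAdd (FScale a s) (FScale b s))
| PC_scaleAl a s t : pcong (FScale a (FMul s t)) (FMul (FScale a s) t)
| PC_scaleAr a s t : pcong (FScale a (FMul s t)) (FMul s (FScale a t)).

Definition pcongb : rel fterm := fun s t => `[< pcong s t >].

Fact pcongb_refl : reflexive pcongb.
Proof. by move=> s; apply/asboolP; exact: PC_refl. Qed.

Fact pcongb_sym : symmetric pcongb.
Proof. by move=> s t; apply/asboolP/asboolP; exact: PC_sym. Qed.

Fact pcongb_trans : transitive pcongb.
Proof. by move=> t s u /asboolP st /asboolP tu; apply/asboolP/(PC_trans st tu). Qed.

Canonical pcongb_equiv := EquivRel pcongb pcongb_refl pcongb_sym pcongb_trans.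

Definition palg : Type := {eq_quot pcongb}%qT.

HB.instance Definition _ := Choice.on palg.
HB.instance Definition _ : EqQuotient fterm pcongb palg := EqQuotient.on palg.

Definition ppi (s : fterm) : palg := (\pi_palg s)%qT.

Lemma ppiP s t : ppi s = ppi t <-> pcong s t.
Proof.
split=> [/eqP|st]; first by rewrite eqmodE => /asboolP.
by apply/eqP; rewrite eqmodE; apply/asboolP.
Qed.

Lemma ppi_surj (a : palg) : ppi (repr a) = a.
Proof. exact: reprK. Qed.

Lemma repr_ppi s : pcong (repr (ppi s)) s.
Proof. by apply/ppiP; rewrite ppi_surj. Qed.

Definition pzero : palg := ppi FZero.
Definition pone : palg := ppi FOne.
Definition popp (a : palg) : palg := ppi (FOpp (repr a)).
Definition padd (a b : palg) : palg := ppi (FAdd (repr a) (repr b)).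
Definition pmul (a b : palg) : palg := ppi (FMul (repr a) (repr b)).
Definition pscale (k : K) (a : palg) : palg := ppi (FScale k (repr a)).

Lemma ppiN s : ppi (FOpp s) = popp (ppi s).
Proof. by apply/ppiP/PC_opp/PC_sym/repr_ppi. Qed.

Lemma ppiD s t : ppi (FAdd s t) = padd (ppi s) (ppi t).
Proof. by apply/ppiP/PC_add; apply/PC_sym/repr_ppi. Qed.

Lemma ppiM s t : ppi (FMul s t) = pmul (ppi s) (ppi t).
Proof. by apply/ppiP/PC_mul; apply/PC_sym/repr_ppi. Qed.

Lemma ppiZ k s : ppi (FScale k s) = pscale k (ppi s).
Proof. by apply/ppiP/PC_scale/PC_sym/repr_ppi. Qed.

Local Ltac lift_axiom ax :=
  move=> *;
  repeat match goal with a : palg |- _ => rewrite -(ppi_surj a); move: (repr a) => {a} ? end;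
  rewrite ?/pzero ?/pone -!(ppiN, ppiD, ppiM, ppiZ); apply/ppiP; exact: ax.

Fact paddA : associative padd. Proof. lift_axiom PC_addA. Qed.
Fact paddC : commutative padd. Proof. lift_axiom PC_addC. Qed.
Fact padd0 : left_id pzero padd. Proof. lift_axiom PC_add0. Qed.
Fact paddN : left_inverse pzero popp padd. Proof. lift_axiom PC_addN. Qed.
HB.instance Definition _ := GRing.isZmodule.Build palg paddA paddC padd0 paddN.

Fact pmulA : associative pmul. Proof. lift_axiom PC_mulA. Qed.
Fact pmul1l : left_id pone pmul. Proof. lift_axiom PC_mul1l. Qed.
Fact pmul1r : right_id pone pmul. Proof. lift_axiom PC_mul1r. Qed.
Fact pmulDl : left_distributive pmul padd. Proof. lift_axiom PC_mulDl. Qed.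
Fact pmulDr : right_distributive pmul padd. Proof. lift_axiom PC_mulDr. Qed.
HB.instance Definition _ :=
  GRing.Zmodule_isPzRing.Build palg pmulA pmul1l pmul1r pmulDl pmulDr.

Fact pscaleA a b v : pscale a (pscale b v) = pscale (a * b) v.
Proof. move: a b v; lift_axiom PC_scaleA. Qed.
Fact pscale1 : left_id 1 pscale. Proof. lift_axiom PC_scale1. Qed.
Fact pscaleDr : right_distributive pscale padd. Proof. lift_axiom PC_scaleDr. Qed.
Fact pscaleDl v a b : pscale (a + b) v = padd (pscale a v) (pscale b v).
Proof. move: v a b; lift_axiom PC_scaleDl. Qed.
Fact pscaleAl k a b : pscale k (pmul a b) = pmul (pscale k a) b.
Proof. move: k a b; lift_axiom PC_scaleAl. Qed.
Fact pscaleAr k a b : pscale k (pmul a b) = pmul a (pscale k b).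
Proof. move: k a b; lift_axiom PC_scaleAr. Qed.
HB.instance Definition _ :=
  GRing.Zmodule_isLmodule.Build K palg pscaleA pscale1 pscaleDr pscaleDl.

Lemma palg_scaleAl k (a b : palg) : k *: (a * b) = (k *: a) * b.
Proof. exact: pscaleAl. Qed.
Lemma palg_scaleAr k (a b : palg) : k *: (a * b) = a * (k *: b).
Proof. exact: pscaleAr. Qed.

End Presentation.

Arguments FVar {K X} _.
Arguments FZero {K X}.
Arguments FOne {K X}.

Declare Scope fterm_scope.
Delimit Scope fterm_scope with FT.
Bind Scope fterm_scope with fterm.
Notation "1" := FOne : fterm_scope.
Notation "0" := FZero : fterm_scope.
Notation "s + t" := (FAdd s t) : fterm_scope.
Notation "s * t" := (FMul s t) : fterm_scope.
Notation "k *: s" := (FScale k%R s) : fterm_scope.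

(* The two-sided inverse of a when there is one (it is then unique), else 0. *)
Definition pinv (A : pzRingType) (a : A) : A :=
  xget 0 [set b | a * b = 1 /\ b * a = 1]%classic.

(* The algebra obtained from palg r by universally adjoining a two-sided
   inverse of every nonzero element. For an Ore domain this is its skew field
   of fractions. *)
Section Fractions.
Variables (K : fieldType) (X : Type) (r : fterm K X -> fterm K X -> Prop).

Inductive frac_gen : Type :=
| FracIn of palg r
| FracInv of {a : palg r | a != 0}.

Local Notation "[ a ]" := (FVar (FracIn a)) : fterm_scope.
Local Notation "[ s ]^-1" := (FVar (FracInv s)) (format "[ s ]^-1") : fterm_scope.

Inductive frac_rel : fterm K frac_gen -> fterm K frac_gen -> Prop :=
| Frac_one : frac_rel [1%R] 1
| Frac_add a b : frac_rel [(a + b)%R] ([a] + [b])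
| Frac_mul a b : frac_rel [(a * b)%R] ([a] * [b])
| Frac_scale k a : frac_rel [(k *: a)%R] (k *: [a])
| Frac_mulV s : frac_rel ([val s] * [s]^-1) 1
| Frac_Vmul s : frac_rel ([s]^-1 * [val s]) 1.

Definition frac : Type := palg frac_rel.
HB.instance Definition _ := GRing.PzRing.on frac.
HB.instance Definition _ := GRing.Lmodule.on frac.

Definition frac_in (a : palg r) : frac := ppi frac_rel [a].

End Fractions.

Definition oddz (n : int) : bool := ~~ (2 %| n)%Z.

Definition delta (m : nat) (n : int) : int := ((m%:Z %| n)%Z : nat)%:Z.

Definition eps (m : nat) (n : int) : rat :=
  (m%:R - 1 - 2 * ((n %% m)%Z)%:~R) / m%:R.

Section Cq.
Variables (K : fieldType) (N L : nat) (q : K).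

Definition Omega (i n : int) : int :=
  2 * delta L n * (delta N i - delta N (i + 1))
  + 2 * delta L (n + 1) * (delta N i - delta N (i - 1)).

Inductive Cgen : Type := Chi of int & int | ChiV of int & int.

Local Notation "'chi_" := (fun i n => FVar (Chi i n)) : fterm_scope.
Local Notation "'chiV_" := (fun i n => FVar (ChiV i n)) : fterm_scope.

(* Indices range over int; the residue classes enter through C_perN, C_per2L. *)
Inductive Crel : fterm K Cgen -> fterm K Cgen -> Prop :=
| C_perN i n : Crel ('chi_ (i + N%:Z)%R n) ('chi_ i n)
| C_per2L i n : Crel ('chi_ i (n + (2 * L)%:Z)%R) ('chi_ i n)
| C_mulV i n : Crel ('chi_ i n * 'chiV_ i n) 1
| C_Vmul i n : Crel ('chiV_ i n * 'chi_ i n) 1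
| C_comm i j n m : ~~ oddz (n - m)%R ->
    Crel ('chi_ i n * 'chi_ j m) ('chi_ j m * 'chi_ i n)
| C_qcomm i j n m : ~~ oddz n -> oddz m ->
    Crel ('chi_ i n * 'chi_ j m)
         ((q ^ Omega (i - j) ((n - m - 1) %/ 2)%Z) *: ('chi_ j m * 'chi_ i n)).

Definition Cq : Type := palg Crel.
HB.instance Definition _ := GRing.PzRing.on Cq.
HB.instance Definition _ := GRing.Lmodule.on Cq.

Definition chi (i n : int) : Cq := ppi Crel ('chi_ i n).

Definition fracC : Type := frac Crel.
HB.instance Definition _ := GRing.PzRing.on fracC.
HB.instance Definition _ := GRing.Lmodule.on fracC.

Definition CinF (a : Cq) : fracC := frac_in a.

(* s = 1 gives the formulas of kappa_+, and s = -1 those of kappa_-. They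
   presuppose n + 1 <> n - 1 mod 2 L and i - 1, i, i + 1 not all equal mod N,
   that is 1 < L and 1 < N: otherwise the corresponding automorphism of Tq
   produces other powers of q in the binomial factors. *)
Definition kappa_formulas (s : int) (k : fracC -> fracC) : Prop :=
  let x i n := CinF (chi i n) in
  (forall i n, ~~ oddz n -> k (x i (n - s)) = x i n) /\
  (forall i n, oddz n ->
     k (x i (n - s)) =
       q ^- 2 *: ((1 - x (i - 1) (n + 1)) * pinv (1 - q ^- 2 *: pinv (x i (n + 1)))
                * ((1 - x (i + 1) (n - 1)) * pinv (1 - q ^- 2 *: pinv (x i (n - 1))))
                * pinv (x i n))).

End Cq.

Definition cexp (R : realType) (z : R[i]) : R[i] :=
  Complex (expR (Re z) * cos (Im z)) (expR (Re z) * sin (Im z)).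

Section Tq.
Variables (R : realType) (N L : nat) (h : R[i]).

(* Meaningful when x + y is odd: the halves below are then exact. *)
Definition G (x y : int) : rat :=
  let F := gcdn L N in
  let J := ((L * N) %/ F)%N in
  2^-1 * \sum_(1 <= j < (N %/ F).+1)
    (((x - y)%:~R / J%:R + eps J (((x - y - 1) %/ 2)%Z + (j * L)%N%:Z))
     * ((x + y)%:~R / N%:R + eps N (((x + y - 1) %/ 2)%Z + (j * L)%N%:Z))).

Inductive Tgen : Type := Tau of int & int | TauV of int & int.

Local Notation "'tau_" := (fun x y => FVar (Tau x y)) : fterm_scope.
Local Notation "'tauV_" := (fun x y => FVar (TauV x y)) : fterm_scope.

Definition eta_term (x y : int) : fterm R[i] Tgen :=
  ('tauV_ (x + 1)%R y * 'tauV_ (x - 1)%R y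
   * ('tau_ x (y - 1)%R * 'tau_ x (y + 1)%R))%FT.

(* Sublattice convention: the factor standing first in T_qcomm, like the
   points moved without change by kappat, is fixed by the convention for Cq
   and by chi_i(n) |-> - eta(n + i, i). As eta(x, y) involves only tau's with
   x + y of the other parity, an even n leads to tau's with x + y odd; so the
   odd factor is the first one, and tau(x -+ 1, y) |-> tau(x, y) holds for
   x + y odd. The opposite choice amounts to renaming tau(x, y) as
   tau(x + 1, y); under it the images of the chi_i(n) would satisfy the
   relations of Cq with q replaced by its inverse. *)
Inductive Trel : fterm R[i] Tgen -> fterm R[i] Tgen -> Prop :=
| T_mulV x y : Trel ('tau_ x y * 'tauV_ x y) 1
| T_Vmul x y : Trel ('tauV_ x y * 'tau_ x y) 1
| T_comm x y x' y' : oddz (x + y)%R = oddz (x' + y')%R ->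
    Trel ('tau_ x y * 'tau_ x' y') ('tau_ x' y' * 'tau_ x y)
| T_qcomm x y x' y' : oddz (x + y)%R -> ~~ oddz (x' + y')%R ->
    Trel ('tau_ x y * 'tau_ x' y')
         (cexp (h * ratr (G (x - x') (y - y'))) *: ('tau_ x' y' * 'tau_ x y))
| T_per2L x y : Trel (eta_term (x + (2 * L)%:Z)%R y) (eta_term x y)
| T_perN x y : Trel (eta_term (x + N%:Z)%R (y + N%:Z)%R) (eta_term x y).

Definition Tq : Type := palg Trel.
HB.instance Definition _ := GRing.PzRing.on Tq.
HB.instance Definition _ := GRing.Lmodule.on Tq.

Definition tau (x y : int) : Tq := ppi Trel ('tau_ x y).

Definition eta (x y : int) : Tq :=
  pinv (tau (x - 1) y * tau (x + 1) y) * tau x (y - 1) * tau x (y + 1).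

Definition fracT : Type := frac Trel.
HB.instance Definition _ := GRing.PzRing.on fracT.
HB.instance Definition _ := GRing.Lmodule.on fracT.

Definition TinF (a : Tq) : fracT := frac_in a.

Definition kappat_formulas (s : int) (k : fracT -> fracT) : Prop :=
  let t x y := TinF (tau x y) in
  (forall x y, oddz (x + y) -> k (t (x - s) y) = t x y) /\
  (forall x y, ~~ oddz (x + y) ->
     k (t (x - s) y) =
       - ((t (x + 1) y * t (x - 1) y + t x (y + 1) * t x (y - 1))
          * pinv (t x y))).

End Tq.

(* Main.v *)
(* G is a Green function: for x + y even its discrete Laplacian
   G(x,y-1) + G(x,y+1) - G(x-1,y) - G(x+1,y) is -2 times the indicator of the
   lattice spanned by (2L,0) and (N,N). Hence eta commutes with tau up to
   q^(-2 delta), and taking the Laplacian once more gives the exponent Omega for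
   a pair of eta's; this yields iota.
   To pass to fractions, iota must not kill a nonzero element unless Tq is
   trivial. For t = exp(G(. - p)) the rescaling tau |-> t tau is an automorphism
   of Tq that multiplies eta by exp(-2) on one periodicity class and fixes it on
   the others, so by Dedekind's argument the images of distinct Laurent monomials
   in the chi's are linearly independent.
   On chi_i(n) with n odd, both compositions are compared after multiplying out
   the images of the tau's; the remaining power of q cancels because
   G(1,2) + G(-1,2) - G(2,1) - G(2,-1) = -2, which follows from the Laplacian
   at three points and from G(-x,-y) = G(x,y). *)
From HB Require Import structures.
Require Import Defs.
From mathcomp Require Import all_boot all_order all_algebra.
From mathcomp Require Import classical_sets reals exp trigo complex.
From mathcomp Require Import zify ring lra.

Set Implicit Arguments.
Unset Strict Implicit.
Unset Printing Implicit Defensive.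

Import Order.TTheory GRing.Theory Num.Theory.
Local Open Scope ring_scope.

(** * The discrete Laplacian of G *)

Lemma even_exists (n : int) : ~~ oddz n -> exists m, n = 2 * m.
Proof. rewrite /oddz negbK => /dvdzP[m ->]; exists m; ring. Qed.

Lemma modz_eqP (m : nat) (n r k : int) : (0 <= r < m%:Z) ->
  n = k * m%:Z + r -> (n %% m)%Z = r.
Proof. by move=> rm ->; rewrite modzMDl modz_small. Qed.

(** The residue grows by 1 at each step, which lowers [eps] by 2/m; at a multiple of m it falls back
    from m - 1 to 0, which adds 2. *)
Lemma eps_step (m : nat) (n : int) : (0 < m)%N ->
  eps m n - eps m (n - 1) = 2 * (delta m n)%:~R - 2 / m%:R.
Proof.
move=> m0; rewrite /eps /delta -mulrBl.
have m0' : (m%:R : rat) != 0 by rewrite pnatr_eq0 -lt0n.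
have [d|nd] := boolP (m%:Z %| n)%Z.
  have -> : (n %% m)%Z = 0 by apply/dvdz_mod0P.
  have -> : ((n - 1) %% m)%Z = m%:Z - 1.
    case/dvdzP: d => c ->; apply: (@modz_eqP _ _ _ (c - 1)); first by lia.
    ring.
  by rewrite rmorphB /=; field.
have n1 : (n %% m)%Z != 0 by apply: contra nd => /eqP/dvdz_mod0P.
have n2 : (n %% m)%Z < m by rewrite ltz_pmod.
have n3 : 0 <= (n %% m)%Z by rewrite modz_ge0 //; lia.
have -> : ((n - 1) %% m)%Z = (n %% m)%Z - 1.
  apply: (@modz_eqP _ _ _ (n %/ m)%Z); first by lia.
  by rewrite addrA -divz_eq.
by move: (n %% m)%Z => r; rewrite rmorphB /=; field.
Qed.

Lemma eps_period (m : nat) (n k : int) : eps m (n + k * m%:Z) = eps m n.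
Proof. by rewrite /eps (addrC n) modzMDl. Qed.

(** The residues of n and -1 - n add up to m - 1, and [eps] is odd about the midpoint (m - 1)/2. *)
Lemma eps_opp (m : nat) (n : int) : (0 < m)%N -> eps m (- 1 - n) = - eps m n.
Proof.
move=> m0; rewrite /eps.
have n2 : (n %% m)%Z < m by rewrite ltz_pmod.
have n3 : 0 <= (n %% m)%Z by rewrite modz_ge0 //; lia.
have -> : ((- 1 - n) %% m)%Z = m%:Z - 1 - (n %% m)%Z.
  apply: (@modz_eqP _ _ _ (- 1 - (n %/ m)%Z)); first by lia.
  rewrite [in LHS](divz_eq n m); ring.
have m0' : (m%:R : rat) != 0 by rewrite pnatr_eq0 -lt0n.
by move: (n %% m)%Z => r; rewrite !rmorphB /=; field.
Qed.

Lemma delta_unit m (k : int) : (1 < m)%N -> `|k|%N = 1%N -> delta m k = 0.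
Proof.
move=> m1 k1; rewrite /delta; case: (boolP (_ %| _)%Z) => // /dvdzP[c kc].
by move: k1 m1; rewrite kc abszM => /eqP; rewrite muln_eq1 => /andP[_ /eqP /= ->].
Qed.

(** The differences in [eps_step] telescope to 0 over a full period, so the delta terms must balance
    the m terms 2/m. *)
Lemma sum_delta (m : nat) (c : int) : (0 < m)%N ->
  \sum_(1 <= j < m.+1) delta m (c + j%:Z) = 1.
Proof.
move=> m0.
have m0' : (m%:R : rat) != 0 by rewrite pnatr_eq0 -lt0n.
have : \sum_(1 <= j < m.+1) (2 * (delta m (c + j%:Z))%:~R - 2 / m%:R : rat) = 0.
  rewrite big_add1 /=.
  rewrite (eq_bigr (fun j : nat => eps m (c + j.+1%:Z) - eps m (c + j%:Z))) => [|j _].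
    rewrite (telescope_sumr (fun j : nat => eps m (c + j%:Z))) //.
    by rewrite -(mul1r m%:Z) eps_period addr0 subrr.
  by rewrite -eps_step // (_ : c + j.+1%:Z - 1 = c + j%:Z); last lia.
rewrite sumrB -mulr_sumr sumr_const_nat subSS subn0 -[_ *+ m]mulr_natr divfK //.
rewrite -rmorph_sum /= => /eqP; rewrite subr_eq0 -[X in _ == X]mulr1.
by rewrite (inj_eq (mulfI _)) // -[1]/(1%:~R) (inj_eq intr_inj) => /eqP.
Qed.

(** Put m = N/F, so that J = L m and N divides J. A multiple of J among the a + j L forces L to
    divide a; if a = c L, exactly one j in the range has m dividing c + j. For that j, j L is
    congruent to -a modulo J, hence modulo N, which turns the second delta into that of b - a. *)
Lemma sum_delta_shift (L N : nat) (a b : int) : (0 < L)%N -> (0 < N)%N ->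
  \sum_(1 <= j < (N %/ gcdn L N).+1)
     delta ((L * N) %/ gcdn L N) (a + (j * L)%N%:Z) * delta N (b + (j * L)%N%:Z)
  = delta L a * delta N (b - a).
Proof.
move=> L0 N0; set m := (N %/ gcdn L N)%N.
have m0 : (0 < m)%N by rewrite divn_gt0 ?gcdn_gt0 ?L0 // dvdn_leq // dvdn_gcdr.
have -> : ((L * N) %/ gcdn L N = L * m)%N by rewrite muln_divA ?dvdn_gcdr.
have NLm : (N %| L * m)%N by rewrite muln_divCA_gcd dvdn_mulr.
have [La|nLa] := boolP (L%:Z %| a)%Z; last first.
  rewrite [delta L a]/delta (negPf nLa) mul0r big1 // => j _.
  rewrite /delta; case: (boolP (_ %| a + _)%Z) => [|_]; last by rewrite mul0r.
  have LLm : (L%:Z %| (L * m)%N%:Z)%Z by rewrite PoszM dvdz_mulr.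
  move=> /(dvdz_trans LLm).
  by rewrite PoszM rpredDr ?dvdz_mull // (negPf nLa).
rewrite [delta L a]/delta La mul1r -[RHS]mul1r -(@sum_delta m (a %/ L)%Z m0) mulr_suml.
apply: eq_bigr => j _; case/dvdzP: La => c ->.
rewrite mulzK; last by lia.
rewrite /delta !PoszM [c * _]mulrC [j%:Z * _]mulrC -mulrDr dvdz_mul2l; last by lia.
have [/dvdzP[e cj]|_] := boolP (m%:Z %| c + j)%Z; last by rewrite !mul0r.
rewrite !mul1r; congr (Posz (nat_of_bool _)).
have -> : L%:Z * j%:Z = - (L%:Z * c) + e * (L * m)%N%:Z.
  by rewrite PoszM -[in LHS](addKr c j%:Z) cj; ring.
by rewrite addrA (rpredDr _ (dvdz_mull _ _)) // dvdz_mull.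
Qed.

(** In the coordinates a = (x - y)/2, b = (x + y)/2 each summand of [G] is a product of a function
    f, taken at a or a - 1, and a function g, taken at b or b - 1. Its Laplacian is -(f(a) - f(a -
    1)) (g(b) - g(b - 1)). The linear terms cancel the slopes of the sawtooth [eps], so each
    difference is twice a delta. *)
Lemma G_laplacian (N L : nat) (x y : int) : (0 < N)%N -> (0 < L)%N ->
  ~~ oddz (x + y) ->
  G N L x (y - 1) + G N L x (y + 1) - G N L (x - 1) y - G N L (x + 1) y
  = (- 2 * (delta L ((x - y) %/ 2)%Z * delta N y))%:~R.
Proof.
move=> N0 L0 /even_exists[b xyE]; pose a := b - y.
have -> : x = a + b by rewrite /a; lia.
have -> : y = b - a by rewrite /a; lia.
have {xyE} -> : ((a + b - (b - a)) %/ 2)%Z = a by lia.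
rewrite -(sum_delta_shift a b L0 N0) /G; set J := (L * N %/ _)%N; set m := (N %/ _)%N.
rewrite -!mulrDr -!mulrBr -big_split -!sumrB /= mulr_sumr mulr_sumr rmorph_sum /=.
apply: eq_bigr => j _.
have J0 : (0 < J)%N.
  rewrite /J -muln_divA ?dvdn_gcdr // muln_gt0 L0 divn_gt0 ?gcdn_gt0 ?L0 //.
  by rewrite dvdn_leq // dvdn_gcdr.
have hJ := eps_step (a + (j * L)%N%:Z) J0.
have hN := eps_step (b + (j * L)%N%:Z) N0.
set jl := Posz (j * L) in hJ hN *.
have -> : ((a + b - (b - a - 1) - 1) %/ 2)%Z = a by lia.
have -> : ((a + b - (b - a + 1) - 1) %/ 2)%Z = a - 1 by lia.
have -> : ((a + b - 1 - (b - a) - 1) %/ 2)%Z = a - 1 by lia.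
have -> : ((a + b + 1 - (b - a) - 1) %/ 2)%Z = a by lia.
have -> : ((a + b + (b - a - 1) - 1) %/ 2)%Z = b - 1 by lia.
have -> : ((a + b + (b - a + 1) - 1) %/ 2)%Z = b by lia.
have -> : ((a + b - 1 + (b - a) - 1) %/ 2)%Z = b - 1 by lia.
have -> : ((a + b + 1 + (b - a) - 1) %/ 2)%Z = b by lia.
rewrite !(addrAC _ (-1)).
move/eqP: hJ; rewrite subr_eq => /eqP ->.
move/eqP: hN; rewrite subr_eq => /eqP ->.
have J0' : (J%:R : rat) != 0 by rewrite pnatr_eq0 -lt0n.
have N0' : (N%:R : rat) != 0 by rewrite pnatr_eq0 -lt0n.
rewrite !(rmorphB, rmorphD, rmorphM, rmorphN) /=.
by field; rewrite J0' N0'.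
Qed.

(** The substitution j -> m - j moves the range to 0, ..., m - 1; periodicity identifies the end
    terms f(0) and f(m L). *)
Lemma sum_period_opp (V : zmodType) (f : int -> V) (m L : nat) :
  (forall n, f (n + (m * L)%N%:Z) = f n) ->
  \sum_(1 <= j < m.+1) f (- (j * L)%N%:Z) = \sum_(1 <= j < m.+1) f (j * L)%N%:Z.
Proof.
move=> fP; rewrite !big_add1 /= big_nat_rev /=.
transitivity (\sum_(0 <= j < m) f (j * L)%N%:Z).
  rewrite !big_mkord; apply: eq_bigr => j _.
  rewrite -[LHS]fP; congr (f _); rewrite add0n subnSK // mulnBl.
  have : (j * L <= m * L)%N by rewrite leq_mul // ltnW.
  lia.
apply/eqP; rewrite eq_sym -subr_eq0 -sumrB telescope_sumr //.
by rewrite -[X in _ - f X]/(0 : int) -(fP 0) add0r subrr.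
Qed.

(** Negating (x, y) sends a = (x - y - 1)/2 to -1 - a, and (x + y - 1)/2 likewise, so by [eps_opp]
    both factors of a summand change sign while j L becomes -j L. As N divides J = m L, the summand
    has period m L in j L, and [sum_period_opp] applies. *)
Lemma G_even (N L : nat) (x y : int) : (0 < N)%N -> (0 < L)%N ->
  oddz (x + y) -> G N L (- x) (- y) = G N L x y.
Proof.
move=> N0 L0 xy; rewrite /G; congr (_ * _).
set J := (L * N %/ _)%N; set m := (N %/ _)%N.
have m0 : (0 < m)%N by rewrite divn_gt0 ?gcdn_gt0 ?L0 // dvdn_leq // dvdn_gcdr.
have JE : J = (m * L)%N by rewrite /J -muln_divA ?dvdn_gcdr // mulnC.
have J0 : (0 < J)%N by rewrite JE muln_gt0 m0.
have [e NLm] : exists e, (m * L = e * N)%N.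
  by apply/dvdnP; rewrite mulnC muln_divCA_gcd dvdn_mulr.
pose f (n : int) : rat :=
  ((x - y)%:~R / J%:R + eps J (((x - y - 1) %/ 2)%Z + n))
  * ((x + y)%:~R / N%:R + eps N (((x + y - 1) %/ 2)%Z + n)).
rewrite -[RHS](@sum_period_opp _ f m L) => [|n]; last first.
  by rewrite /f !addrA [in eps N _]NLm -JE -(mul1r J%:Z) PoszM !eps_period.
apply: eq_bigr => j _; rewrite /f.
have {xy} [k xyE] : exists k, x + y = 2 * k + 1.
  have /even_exists[k xyE] : ~~ oddz (x + y - 1) by move: xy; rewrite /oddz; lia.
  by exists k; rewrite -xyE; ring.
pose a := k - y; have -> : x = a + k + 1 by rewrite /a; lia.
have -> : y = k - a by rewrite /a; lia.
set jl := Posz (j * L).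
have -> : ((- (a + k + 1) - - (k - a) - 1) %/ 2)%Z + jl = - 1 - (a - jl) by lia.
have -> : ((- (a + k + 1) + - (k - a) - 1) %/ 2)%Z + jl = - 1 - (k - jl) by lia.
have -> : ((a + k + 1 - (k - a) - 1) %/ 2)%Z = a by lia.
have -> : ((a + k + 1 + (k - a) - 1) %/ 2)%Z = k by lia.
rewrite !eps_opp // !(rmorphB, rmorphD, rmorphN) /=.
have J0' : (J%:R : rat) != 0 by rewrite pnatr_eq0 -lt0n.
have N0' : (N%:R : rat) != 0 by rewrite pnatr_eq0 -lt0n.
by field; rewrite J0' N0'.
Qed.

(** * Presented algebras *)

Section PalgTheory.
Variables (K : fieldType) (X : Type) (r : fterm K X -> fterm K X -> Prop).

Lemma ppi_add s t : ppi r (FAdd s t) = ppi r s + ppi r t. Proof. exact: ppiD. Qed.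
Lemma ppi_mul s t : ppi r (FMul s t) = ppi r s * ppi r t. Proof. exact: ppiM. Qed.
Lemma ppi_opp s : ppi r (FOpp s) = - ppi r s. Proof. exact: ppiN. Qed.
Lemma ppi_scale k s : ppi r (FScale k s) = k *: ppi r s. Proof. exact: ppiZ. Qed.
Lemma ppi_zero : ppi r FZero = 0. Proof. by []. Qed.
Lemma ppi_one : ppi r FOne = 1. Proof. by []. Qed.
Definition ppiE := (ppi_add, ppi_mul, ppi_opp, ppi_scale, ppi_zero, ppi_one).

Lemma ppi_rel s t : r s t -> ppi r s = ppi r t.
Proof. by move=> rst; apply/ppiP/PC_rel. Qed.

End PalgTheory.

Section PalgMorphisms.
Variables (K : fieldType) (X X' : Type).
Variables (r : fterm K X -> fterm K X -> Prop) (r' : fterm K X' -> fterm K X' -> Prop).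
Implicit Types (g : X -> palg r').

Fixpoint fterm_eval g (s : fterm K X) : palg r' :=
  match s with
  | FVar x => g x
  | FZero => 0
  | FOne => 1
  | FOpp s => - fterm_eval g s
  | FAdd s t => fterm_eval g s + fterm_eval g t
  | FMul s t => fterm_eval g s * fterm_eval g t
  | FScale k s => k *: fterm_eval g s
  end.

(** The universal property of a presentation: every rule of [pcong] holds in the target, so
    evaluation is constant on classes and may be computed on [repr]. *)
Lemma palg_lift g : (forall s t, r s t -> fterm_eval g s = fterm_eval g t) ->
  exists f : {rmorphism palg r -> palg r'},
    scalable f /\ forall x, f (ppi r (FVar x)) = g x.
Proof.
move=> gr.
have ev_cong s t : pcong r s t -> fterm_eval g s = fterm_eval g t.
  elim=> /= [{}s {}t /gr //|//|//|* |? ? _ ->|? ? ? ? _ -> _ ->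
    |? ? ? ? _ -> _ ->|? ? ? _ ->|*|*|*|*|*|*|*|*|*|*|*|*|*|*|*] //;
    try by [etransitivity; eassumption].
  - exact: addrA.
  - exact: addrC.
  - exact: add0r.
  - exact: addNr.
  - exact: mulrA.
  - exact: mul1r.
  - exact: mulr1.
  - exact: mulrDl.
  - exact: mulrDr.
  - exact: scalerA.
  - exact: scale1r.
  - exact: scalerDr.
  - exact: scalerDl.
  - exact: palg_scaleAl.
  - exact: palg_scaleAr.
pose f (a : palg r) := fterm_eval g (repr a).
have fE s : f (ppi r s) = fterm_eval g s by apply/ev_cong/repr_ppi.
have fB : zmod_morphism f.
  move=> a b; rewrite -(ppi_surj a) -(ppi_surj b).
  by rewrite -(ppi_opp r) -(ppi_add r) !fE.
have fM : monoid_morphism f.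
  split=> [|a b]; first exact: (fE FOne).
  by rewrite -(ppi_surj a) -(ppi_surj b) -(ppi_mul r) !fE.
pose fZ := GRing.isZmodMorphism.Build _ _ f fB.
pose fR := GRing.isMonoidMorphism.Build _ _ f fM.
pose F : {rmorphism palg r -> palg r'} := HB.pack f fZ fR.
exists F; split=> [k a|x]; last exact: (fE (FVar x)).
by rewrite /= -(ppi_surj a) -(ppi_scale r) !fE.
Qed.

(** Morphisms as a predicate on plain functions, so that [frac_in] and composites qualify without
    being bundled; 0 and opposites follow by scaling with 0 and -1. *)
Definition algebra_map (f : palg r -> palg r') :=
  [/\ f 1 = 1, forall a b, f (a + b) = f a + f b,
      forall a b, f (a * b) = f a * f b & forall k a, f (k *: a) = k *: f a].

Lemma algebra_map_rmorphism (f : {rmorphism palg r -> palg r'}) :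
  scalable f -> algebra_map f.
Proof. by move=> fZ; split; [exact: rmorph1|exact: rmorphD|exact: rmorphM|]. Qed.

Lemma algebra_map_ext (f f' : palg r -> palg r') :
  algebra_map f -> algebra_map f' ->
  (forall x, f (ppi r (FVar x)) = f' (ppi r (FVar x))) -> f =1 f'.
Proof.
move=> [f1 fD fM fZ] [f'1 f'D f'M f'Z] ff' a; rewrite -(ppi_surj a).
elim: (repr a) => [x|||s IHs|s IHs t IHt|s IHs t IHt|k s IHs]; first exact: ff'.
- by rewrite ppi_zero -[0](scale0r 0) fZ f'Z !scale0r.
- by rewrite ppi_one f1 f'1.
- by rewrite ppi_opp -scaleN1r fZ f'Z IHs.
- by rewrite ppi_add fD f'D IHs IHt.
- by rewrite ppi_mul fM f'M IHs IHt.
- by rewrite ppi_scale fZ f'Z IHs.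
Qed.

End PalgMorphisms.

Definition inverses (A : pzRingType) (a b : A) := a * b = 1 /\ b * a = 1.

Lemma inverses_sym (A : pzRingType) (a b : A) : inverses a b -> inverses b a.
Proof. by case. Qed.

Lemma inverses_inj (A : pzRingType) (a b b' : A) : inverses a b -> inverses a b' -> b = b'.
Proof. by move=> [ab ba] [ab' b'a]; rewrite -[b]mulr1 -ab' mulrA ba mul1r. Qed.

Lemma pinvE (A : pzRingType) (a b : A) : inverses a b -> pinv a = b.
Proof.
move=> ab; rewrite /pinv; case: xgetP => [c _ ac|nab]; last by case: (nab b).
exact: inverses_inj ac ab.
Qed.

Lemma pinvP (A : pzRingType) (a : A) : inverses a (pinv a) \/ pinv a = 0.
Proof. by rewrite /pinv; case: xgetP => [c -> ac|_]; [left|right]. Qed.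

Lemma inversesM (A : pzRingType) (a a' b b' : A) :
  inverses a a' -> inverses b b' -> inverses (a * b) (b' * a').
Proof.
move=> [aa' a'a] [bb' b'b]; split.
  by rewrite mulrA -(mulrA a) bb' mulr1.
by rewrite mulrA -(mulrA b') a'a mulr1.
Qed.

Lemma inversesN (A : pzRingType) (a a' : A) : inverses a a' -> inverses (- a) (- a').
Proof. by move=> [aa' a'a]; split; rewrite mulrNN. Qed.

Lemma inverses1 (A : pzRingType) : inverses (1 : A) 1.
Proof. by split; rewrite mul1r. Qed.

Lemma inverses_morph (A B : pzRingType) (f : {rmorphism A -> B}) a a' :
  inverses a a' -> inverses (f a) (f a').
Proof. by move=> [aa' a'a]; split; rewrite -rmorphM ?aa' ?a'a rmorph1. Qed.

(** * Commutation up to a scalar *)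

Section QCommute.
Variables (K : fieldType) (X : Type) (r : fterm K X -> fterm K X -> Prop).
Implicit Types (a b c : palg r) (l m : K).

Definition qcomm l a b := a * b = l *: (b * a).

Lemma qcommMr l m a b c : qcomm l a b -> qcomm m a c -> qcomm (l * m) a (b * c).
Proof.
rewrite /qcomm => ab ac.
by rewrite mulrA ab -palg_scaleAl -mulrA ac -palg_scaleAr scalerA mulrA.
Qed.

Lemma qcommMl l m a b c : qcomm l a c -> qcomm m b c -> qcomm (l * m) (a * b) c.
Proof.
rewrite /qcomm => ac bc.
by rewrite -mulrA bc -palg_scaleAr mulrA ac -palg_scaleAl scalerA mulrC mulrA.
Qed.

Lemma qcommVr l a b b' : l != 0 -> inverses b b' -> qcomm l a b -> qcomm l^-1 a b'.
Proof.
rewrite /qcomm => l0 [bb' b'b] ab.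
have : b' * (a * b) * b' = l *: (a * b').
  by rewrite ab -palg_scaleAr -palg_scaleAl !mulrA b'b mul1r.
rewrite -!mulrA bb' mulr1 => ->.
by rewrite scalerA mulVf // scale1r.
Qed.

Lemma qcomm_sym l a b : l != 0 -> qcomm l a b -> qcomm l^-1 b a.
Proof. by rewrite /qcomm => l0 ->; rewrite scalerA mulVf // scale1r. Qed.

Lemma qcommVl l a a' b : l != 0 -> inverses a a' -> qcomm l a b -> qcomm l^-1 a' b.
Proof.
move=> l0 aa' ab; have l0' : l^-1 != 0 by rewrite invr_eq0.
rewrite -[l^-1]invrK; apply: qcomm_sym; first by rewrite invr_eq0.
exact: qcommVr aa' (qcomm_sym l0 ab).
Qed.

Lemma qcommNr l a b : qcomm l a b -> qcomm l a (- b).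
Proof. by rewrite /qcomm mulrN mulNr scalerN => ->. Qed.

Lemma qcommNl l a b : qcomm l a b -> qcomm l (- a) b.
Proof. by rewrite /qcomm mulrN mulNr scalerN => ->. Qed.

Lemma qcomm1P a b : qcomm 1 a b <-> a * b = b * a.
Proof. by rewrite /qcomm scale1r. Qed.

End QCommute.

(** * The complex exponential *)

Section Cexp.
Variable R : realType.
Implicit Types z : R[i].

Lemma cexp0 : cexp (0 : R[i]) = 1.
Proof. by rewrite /cexp /= expR0 cos0 sin0 mulr0 mulr1. Qed.

Lemma cexpD z z' : cexp (z + z') = cexp z * cexp z'.
Proof.
case: z z' => [a b] [c d]; rewrite /cexp /= expRD cosD sinD.
apply/eqP; rewrite eq_complex /=; apply/andP; split; apply/eqP; ring.
Qed.

Lemma cexp_neq0 z : cexp z != 0.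
Proof.
apply/eqP => z0; have := cexpD z (- z).
by rewrite subrr cexp0 z0 mul0r => /eqP; rewrite oner_eq0.
Qed.

Lemma cexpN z : cexp (- z) = (cexp z)^-1.
Proof.
apply: (mulIf (cexp_neq0 z)).
by rewrite -cexpD addNr cexp0 mulVf ?cexp_neq0.
Qed.

Lemma cexp_nat z (n : nat) : cexp (z * n%:R) = cexp z ^+ n.
Proof.
elim: n => [|n IHn]; first by rewrite mulr0 cexp0.
by rewrite mulrS mulrDr mulr1 cexpD IHn exprS.
Qed.

Lemma cexp_int z (n : int) : cexp (z * n%:~R) = cexp z ^ n.
Proof.
case: n => n; first exact: cexp_nat.
by rewrite NegzE rmorphN mulrN cexpN /= cexp_nat.
Qed.

End Cexp.

(** * Commutation relations of eta *)

(** The Laplacian of [G] where x + y is even; it becomes the exponent of q between a tau and an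
    eta. *)
Definition lap (N L : nat) (x y : int) : int :=
  - 2 * (delta L ((x - y) %/ 2)%Z * delta N y).

Lemma cexp_G_laplacian (R : realType) (N L : nat) (z : R[i]) (x y : int) :
  (0 < N)%N -> (0 < L)%N -> ~~ oddz (x + y) ->
  cexp (z * ratr (G N L x (y - 1))) * cexp (z * ratr (G N L x (y + 1)))
    / cexp (z * ratr (G N L (x - 1) y)) / cexp (z * ratr (G N L (x + 1) y))
  = cexp z ^ lap N L x y.
Proof.
move=> N0 L0 xy; rewrite -cexp_int -ratr_int /lap -G_laplacian //.
have ED g g' : cexp (z * ratr (g + g')) = cexp (z * ratr g) * cexp (z * ratr g').
  by rewrite rmorphD mulrDr cexpD.
have EB g g' : cexp (z * ratr (g - g')) = cexp (z * ratr g) / cexp (z * ratr g').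
  by rewrite rmorphB mulrBr cexpD cexpN.
move: (G N L x (y - 1)) (G N L x (y + 1)) (G N L (x - 1) y) (G N L (x + 1) y) => a b c d.
by rewrite !EB ED.
Qed.

Section Eta.
Variables (R : realType) (N L : nat) (h : R[i]).

Local Notation T := (palg (@Trel R N L h)).
Local Notation tau := (tau N L h : int -> int -> T).
Local Notation eta := (eta N L h : int -> int -> T).

Definition tauV (x y : int) : T := ppi (@Trel R N L h) (FVar (TauV x y)).

Definition etaV (x y : int) : T :=
  tauV x (y + 1) * (tauV x (y - 1) * (tau (x - 1) y * tau (x + 1) y)).

Lemma tau_inverses x y : inverses (tau x y) (tauV x y).
Proof.
by split; [have := ppi_rel (T_mulV N L h x y)|have := ppi_rel (T_Vmul N L h x y)];
  rewrite !ppiE.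
Qed.

Lemma eta_tau x y :
  eta x y = tauV (x + 1) y * tauV (x - 1) y * tau x (y - 1) * tau x (y + 1).
Proof. by rewrite /eta (pinvE (inversesM (tau_inverses _ _) (tau_inverses _ _))). Qed.

Lemma eta_ppi x y : eta x y = ppi (@Trel R N L h) (eta_term _ x y).
Proof. by rewrite eta_tau /eta_term !ppi_mul !mulrA. Qed.

Lemma eta_inverses x y : inverses (eta x y) (etaV x y).
Proof.
rewrite eta_tau; apply: inversesM; last exact: tau_inverses.
apply: inversesM; last exact: tau_inverses.
by apply: inversesM; exact/inverses_sym/tau_inverses.
Qed.

Lemma eta_period2L x y : eta (x + (2 * L)%:Z) y = eta x y.
Proof. by rewrite !eta_ppi; exact: (ppi_rel (T_per2L N L h x y)). Qed.

Lemma eta_periodN x y : eta (x + N%:Z) (y + N%:Z) = eta x y.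
Proof. by rewrite !eta_ppi; exact: (ppi_rel (T_perN N L h x y)). Qed.

Lemma tau_comm x y x' y' : oddz (x + y) = oddz (x' + y') ->
  qcomm 1 (tau x y) (tau x' y').
Proof. by move=> par; apply/qcomm1P; have := ppi_rel (T_comm N L h par); rewrite !ppiE. Qed.

Lemma tau_qcomm x y x' y' : oddz (x + y) -> ~~ oddz (x' + y') ->
  qcomm (cexp (h * ratr (G N L (x - x') (y - y')))) (tau x y) (tau x' y').
Proof. by move=> o e; have := ppi_rel (T_qcomm N L h o e); rewrite !ppiE. Qed.

Lemma qcomm_eq (K : fieldType) X (r : fterm K X -> fterm K X -> Prop) (l m : K) (a b : palg r) :
  qcomm l a b -> l = m -> qcomm m a b.
Proof. by move=> ab <-. Qed.

(** The scalar against [eta] is a multiplicative Laplacian: the vertical neighbours enter with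
    exponent 1 and the horizontal ones with exponent -1. *)
Lemma qcomm_etar (l1 l2 l3 l4 : R[i]) (a : T) x y :
  qcomm l1 a (tau (x + 1) y) -> qcomm l2 a (tau (x - 1) y) ->
  qcomm l3 a (tau x (y - 1)) -> qcomm l4 a (tau x (y + 1)) ->
  l1 != 0 -> l2 != 0 -> qcomm (l3 * l4 / l2 / l1) a (eta x y).
Proof.
move=> h1 h2 h3 h4 l10 l20; rewrite eta_tau.
apply: qcomm_eq (qcommMr (qcommMr (qcommMr (qcommVr l10 (tau_inverses _ _) h1)
  (qcommVr l20 (tau_inverses _ _) h2)) h3) h4) _.
by field; rewrite l10 l20.
Qed.

Lemma qcomm_etal (l1 l2 l3 l4 : R[i]) (a : T) x y :
  qcomm l1 (tau (x + 1) y) a -> qcomm l2 (tau (x - 1) y) a ->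
  qcomm l3 (tau x (y - 1)) a -> qcomm l4 (tau x (y + 1)) a ->
  l1 != 0 -> l2 != 0 -> qcomm (l3 * l4 / l2 / l1) (eta x y) a.
Proof.
move=> h1 h2 h3 h4 l10 l20; rewrite eta_tau.
apply: qcomm_eq (qcommMl (qcommMl (qcommMl (qcommVl l10 (tau_inverses _ _) h1)
  (qcommVl l20 (tau_inverses _ _) h2)) h3) h4) _.
by field; rewrite l10 l20.
Qed.

(** [eta X Y] is made of tau's whose coordinate sum has the parity opposite to X + Y, hence that of
    x + y, and these commute with [tau x y]. *)
Lemma tau_eta_comm x y X Y : oddz (x + y) != oddz (X + Y) ->
  qcomm 1 (tau x y) (eta X Y).
Proof.
move=> par.
have -> : 1 = 1 * 1 / 1 / 1 :> R[i] by rewrite !divr1 mulr1.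
by apply: qcomm_etar; rewrite ?oner_eq0 //; apply: tau_comm;
  move: par; rewrite /oddz; lia.
Qed.

Lemma eta_comm X Y X' Y' : oddz (X + Y) = oddz (X' + Y') ->
  qcomm 1 (eta X Y) (eta X' Y').
Proof.
move=> par.
have -> : 1 = 1 * 1 / 1 / 1 :> R[i] by rewrite !divr1 mulr1.
by apply: qcomm_etal; rewrite ?oner_eq0 //; apply: tau_eta_comm;
  move: par; rewrite /oddz; lia.
Qed.

Variable q : R[i].
Hypotheses (N0 : (0 < N)%N) (L0 : (0 < L)%N) (q0 : q != 0) (hq : cexp h = q).

Let E (g : rat) : R[i] := cexp (h * ratr g).

Let EN0 g : E g != 0. Proof. exact: cexp_neq0. Qed.

Let Elap x y : ~~ oddz (x + y) ->
  E (G N L x (y - 1)) * E (G N L x (y + 1)) / E (G N L (x - 1) y) / E (G N L (x + 1) y)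
  = q ^ lap N L x y.
Proof. by move=> xy; rewrite -hq; exact: cexp_G_laplacian. Qed.

Lemma tau_eta_qcomm x y X Y : oddz (x + y) -> oddz (X + Y) ->
  qcomm (q ^ lap N L (x - X) (y - Y)) (tau x y) (eta X Y).
Proof.
move=> o o'; have par : ~~ oddz (x - X + (y - Y)) by move: o o'; rewrite /oddz; lia.
(* Moving (X, Y) to a neighbour moves the difference the opposite way, so each pair of opposite
   neighbours is swapped before matching. *)
rewrite -Elap // [E _ * E _]mulrC -mulrA [_^-1 * _]mulrC mulrA.
apply: qcomm_etar; rewrite ?EN0 //.
- have -> : x - X - 1 = x - (X + 1) by ring.
  by apply: tau_qcomm => //; move: o'; rewrite /oddz; lia.
- have -> : x - X + 1 = x - (X - 1) by ring.
  by apply: tau_qcomm => //; move: o'; rewrite /oddz; lia.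
- have -> : y - Y + 1 = y - (Y - 1) by ring.
  by apply: tau_qcomm => //; move: o'; rewrite /oddz; lia.
- have -> : y - Y - 1 = y - (Y + 1) by ring.
  by apply: tau_qcomm => //; move: o'; rewrite /oddz; lia.
Qed.

Lemma eta_tau_qcomm x y X Y : ~~ oddz (X + Y) -> ~~ oddz (x + y) ->
  qcomm (q ^ lap N L (X - x) (Y - y)) (eta X Y) (tau x y).
Proof.
move=> o o'; have par : ~~ oddz (X - x + (Y - y)) by move: o o'; rewrite /oddz; lia.
rewrite -Elap //.
apply: qcomm_etal; rewrite ?EN0 //.
- rewrite addrAC; by apply: tau_qcomm => //; move: o; rewrite /oddz; lia.
- rewrite (addrAC X); by apply: tau_qcomm => //; move: o; rewrite /oddz; lia.
- rewrite (addrAC Y); by apply: tau_qcomm => //; move: o; rewrite /oddz; lia.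
- rewrite (addrAC Y); by apply: tau_qcomm => //; move: o; rewrite /oddz; lia.
Qed.

(** A second Laplacian, now over the four tau's in the first factor, whose exponents against
    [eta X' Y'] are values of [lap]. *)
Lemma eta_qcomm X Y X' Y' : ~~ oddz (X + Y) -> oddz (X' + Y') ->
  qcomm (q ^ (lap N L (X - X') (Y - 1 - Y') + lap N L (X - X') (Y + 1 - Y')
              - lap N L (X - 1 - X') (Y - Y') - lap N L (X + 1 - X') (Y - Y')))
    (eta X Y) (eta X' Y').
Proof.
move=> e o.
have qB a b : q ^ (a - b) = q ^ a / q ^ b by rewrite expfzDr // invr_expz.
rewrite 2!qB expfzDr //.
by apply: qcomm_etal; rewrite ?expfz_neq0 //; apply: tau_eta_qcomm => //;
  move: e o; rewrite /oddz; lia.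
Qed.

(** With r = (n - m - 1)/2 the four half-differences are r or r + 1: two terms carry [delta L r] and
    two [delta L (r + 1)], the two halves of [Omega]. *)
Lemma lap_Omega i j n m : ~~ oddz n -> oddz m ->
  lap N L (n + i - (m + j)) (i - 1 - j) + lap N L (n + i - (m + j)) (i + 1 - j)
   - lap N L (n + i - 1 - (m + j)) (i - j) - lap N L (n + i + 1 - (m + j)) (i - j)
  = Omega N L (i - j) ((n - m - 1) %/ 2)%Z.
Proof.
move=> e o; rewrite /lap /Omega.
set r := ((n - m - 1) %/ 2)%Z.
have nm : n = m + 1 + 2 * r by rewrite /r; move: e o; rewrite /oddz; lia.
have -> : ((n + i - (m + j) - (i - 1 - j)) %/ 2)%Z = r + 1 by lia.
have -> : ((n + i - (m + j) - (i + 1 - j)) %/ 2)%Z = r by lia.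
have -> : ((n + i - 1 - (m + j) - (i - j)) %/ 2)%Z = r by lia.
have -> : ((n + i + 1 - (m + j) - (i - j)) %/ 2)%Z = r + 1 by lia.
rewrite !(addrAC i _ (- j)); ring.
Qed.

(** At the point (n + i, i) the periods of i and n become the translations (N, N) and (2L, 0), and
    the coordinate sum n + 2i has the parity of n. The sign does not affect commutation up to
    scalars. *)
Lemma iota_exists :
  exists f : {rmorphism palg (Crel N L q) -> T},
    [/\ scalable f,
        forall i n, f (ppi (Crel N L q) (FVar (Chi i n))) = - eta (n + i) i &
        forall i n, f (ppi (Crel N L q) (FVar (ChiV i n))) = - etaV (n + i) i].
Proof.
pose g (x : Cgen) : T :=
  match x with Chi i n => - eta (n + i) i | ChiV i n => - etaV (n + i) i end.
have gr s t : Crel N L q s t -> fterm_eval g s = fterm_eval g t.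
  case=> [i n|i n|i n|i n|i j n m par|i j n m e o] /=.
  - by rewrite addrA eta_periodN.
  - by rewrite addrAC eta_period2L.
  - by case: (inversesN (eta_inverses (n + i) i)).
  - by case: (inversesN (eta_inverses (n + i) i)).
  - apply/qcomm1P/qcommNl/qcommNr/eta_comm.
    by move: par; rewrite /oddz; lia.
  - apply/qcommNl/qcommNr; rewrite -lap_Omega //; apply: eta_qcomm.
      by move: e; rewrite /oddz; lia.
    by move: o; rewrite /oddz; lia.
have [f [fZ fg]] := palg_lift gr.
by exists f; split=> // i n; rewrite fg.
Qed.

End Eta.

(** * The torus action on Tq *)

Lemma lap_period2L (N L : nat) (x y : int) : lap N L (x + (2 * L)%:Z) y = lap N L x y.
Proof.
rewrite /lap /delta.
have -> : ((x + (2 * L)%:Z - y) %/ 2)%Z = ((x - y) %/ 2)%Z + L%:Z by lia.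
by rewrite rpredDr // dvdzz.
Qed.

Lemma lap_periodN (N L : nat) (x y : int) : lap N L (x + N%:Z) (y + N%:Z) = lap N L x y.
Proof.
rewrite /lap /delta (_ : x + N%:Z - (y + N%:Z) = x - y); last by ring.
by rewrite rpredDr // dvdzz.
Qed.

Section Torus.
Variables (R : realType) (N L : nat) (h : R[i]).
Hypotheses (N0 : (0 < N)%N) (L0 : (0 < L)%N).

Local Notation T := (palg (@Trel R N L h)).
Local Notation tau := (tau N L h : int -> int -> T).
Local Notation eta := (eta N L h : int -> int -> T).
Local Notation tauV := (tauV N L h).

(** Rescaling the tau's preserves the commutation relations, whose two sides have the same degree in
    each tau. Only the periodicity relations constrain t, through its multiplicative Laplacian w. *)
Lemma torus_exists (t w : int -> int -> R[i]) :
  (forall x y, t x y != 0) ->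
  (forall x y, w x y = t x (y - 1) * t x (y + 1) / t (x - 1) y / t (x + 1) y) ->
  (forall x y, w (x + (2 * L)%:Z) y = w x y) ->
  (forall x y, w (x + N%:Z) (y + N%:Z) = w x y) ->
  exists f : {rmorphism T -> T},
    scalable f /\ forall x y, f (eta x y) = w x y *: eta x y.
Proof.
move=> t0 wE w2L wN.
pose g (x : Tgen) : T :=
  match x with Tau x y => t x y *: tau x y | TauV x y => (t x y)^-1 *: tauV x y end.
have g_eta x y : fterm_eval g (eta_term _ x y) = w x y *: eta x y.
  rewrite /= eta_tau wE -!(palg_scaleAl, palg_scaleAr) !scalerA !mulrA.
  by congr (_ *: _); field; rewrite !t0.
have gr s s' : Trel N L h s s' -> fterm_eval g s = fterm_eval g s'.
  case=> [x y|x y|x y x' y' par|x y x' y' o e|x y|x y].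
  - rewrite /= -palg_scaleAl -palg_scaleAr scalerA mulfV // scale1r.
    by case: (tau_inverses N L h x y).
  - rewrite /= -palg_scaleAl -palg_scaleAr scalerA mulVf // scale1r.
    by case: (tau_inverses N L h x y).
  - rewrite /= -!(palg_scaleAl, palg_scaleAr) !scalerA [t x' y' * _]mulrC.
    by congr (_ *: _); apply/qcomm1P/tau_comm.
  - rewrite /= -!(palg_scaleAl, palg_scaleAr) !scalerA (tau_qcomm N L h o e) scalerA.
    by congr (_ *: _); ring.
  - by rewrite !g_eta w2L eta_period2L.
  - by rewrite !g_eta wN eta_periodN.
have [f [fZ fg]] := palg_lift gr.
exists f; split=> // x y; rewrite -g_eta eta_ppi.
by rewrite /eta_term !ppi_mul !rmorphM !fg.
Qed.

(* The weight t is exp of G, so that its multiplicative Laplacian w is a delta. *)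
Lemma torus_separates i0 n0 :
  exists f : {rmorphism T -> T}, scalable f /\ forall i n,
    f (eta (n + i) i) =
      (if ((2 * L)%:Z %| n - n0)%Z && (N%:Z %| i - i0)%Z then cexp (- 2) else 1)
        *: eta (n + i) i.
Proof.
pose X0 := n0 + i0.
(* The exponent has 1 in place of h: the nontrivial weight is then exp(-2), of infinite order even
   when q is a root of unity. *)
pose t x y : R[i] :=
  if oddz (x - X0 + (y - i0)) then cexp (1 * ratr (G N L (x - X0) (y - i0))) else 1.
pose w x y : R[i] :=
  if oddz (x - X0 + (y - i0)) then 1 else cexp 1 ^ lap N L (x - X0) (y - i0).
have odd1 x y : oddz (x + 1) = ~~ oddz x /\ oddz (x - 1 + y) = ~~ oddz (x + y).
  by rewrite /oddz; split; lia.
have [||||f [fZ f_eta]] := @torus_exists t w.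
- by move=> x y; rewrite /t; case: ifP => _; rewrite ?cexp_neq0 ?oner_eq0.
- move=> x y; rewrite /t /w.
  have -> : oddz (x - X0 + (y - 1 - i0)) = ~~ oddz (x - X0 + (y - i0)) by rewrite /oddz; lia.
  have -> : oddz (x - X0 + (y + 1 - i0)) = ~~ oddz (x - X0 + (y - i0)) by rewrite /oddz; lia.
  have -> : oddz (x - 1 - X0 + (y - i0)) = ~~ oddz (x - X0 + (y - i0)) by rewrite /oddz; lia.
  have -> : oddz (x + 1 - X0 + (y - i0)) = ~~ oddz (x - X0 + (y - i0)) by rewrite /oddz; lia.
  have [o|e] := boolP (oddz _); first by rewrite /= mulr1 !divr1.
  by rewrite /= -(cexp_G_laplacian _ N0 L0 e) !(addrAC x _ (- X0)) !(addrAC y _ (- i0)).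
- move=> x y; rewrite /w (addrAC x) lap_period2L.
  by congr (if _ then _ else _); rewrite /oddz; lia.
- move=> x y; rewrite /w (addrAC x) (addrAC y) lap_periodN.
  by congr (if _ then _ else _); rewrite /oddz; lia.
exists f; split=> // i n; rewrite f_eta /w /lap /delta; congr (_ *: _).
rewrite /X0 (_ : n + i - (n0 + i0) + (i - i0) = n - n0 + 2 * (i - i0)); last by ring.
rewrite (_ : n + i - (n0 + i0) - (i - i0) = n - n0); last by ring.
have -> : oddz (n - n0 + 2 * (i - i0)) = oddz (n - n0) by rewrite /oddz; lia.
have [o|/even_exists[m ->]] := boolP (oddz _).
  case: ifP => // /andP[/dvdzP[k nk] _]; move: o; rewrite nk /oddz PoszM mulrCA.
  by rewrite dvdz_mulr.
rewrite mulKz // PoszM dvdz_mul2l //.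
case: (_ %| m)%Z; rewrite /= ?mul0r ?mulr0 ?expr0z //.
case: (_ %| _)%Z; rewrite /= ?mul0r ?mulr0 ?expr0z //.
by rewrite -cexp_int mul1r mulr1 rmorphN.
Qed.

End Torus.

(** On real arguments [cexp] is the real exponential, which is injective. *)
Lemma cexpN2_expz_inj (R : realType) : injective (fun k : int => cexp (- 2 : R[i]) ^ k).
Proof.
move=> k k'; rewrite /= -!cexp_int /cexp.
have E (m : int) : (- 2 * m%:~R : R[i]) = (- 2 * m%:~R)%:C%C.
  by rewrite rmorphM rmorphN rmorph_int rmorph_nat.
rewrite !E /= cos0 sin0 !mulr1 => -[/expR_inj] /(mulfI _) H _.
by apply: intr_inj (H _); rewrite oppr_eq0 pnatr_eq0.
Qed.

(** * Injectivity of iota *)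

(** Integer powers with the inverse a' given as data, since the rings carry no unit structure. *)
Definition zpow (A : pzRingType) (a a' : A) (k : int) : A :=
  match k with Posz m => a ^+ m | Negz m => a' ^+ m.+1 end.

Lemma zpow_succ (A : pzRingType) (a a' : A) (k : int) : inverses a a' ->
  a * zpow a a' k = zpow a a' (k + 1).
Proof.
move=> [aa' a'a]; case: k => [m|[|m]].
- have -> : Posz m + 1 = Posz m.+1 by lia.
  by rewrite /= exprS.
- by rewrite /= aa'.
- have -> : Negz m.+1 + 1 = Negz m by lia.
  by rewrite /= exprS mulrA aa' mul1r.
Qed.

Lemma zpow_pred (A : pzRingType) (a a' : A) (k : int) : inverses a a' ->
  a' * zpow a a' k = zpow a a' (k - 1).
Proof.
move=> [aa' a'a]; case: k => [[|m]|m].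
- by rewrite /= mulr1.
- have -> : Posz m.+1 - 1 = Posz m by lia.
  by rewrite /= exprS mulrA a'a mul1r.
- have -> : Negz m - 1 = Negz m.+1 by lia.
  by rewrite /= -exprS.
Qed.

Lemma zpow_inverses (A : pzRingType) (a a' : A) (k : int) : inverses a a' ->
  inverses (zpow a a' k) (zpow a' a k).
Proof.
move=> [aa' a'a]; have cm : GRing.comm a a' by rewrite /GRing.comm aa'.
by split; case: k => m /=; rewrite -exprMn_comm ?aa' ?a'a ?expr1n //;
  apply: commr_sym.
Qed.

Lemma zpow_morph (A B : pzRingType) (f : {rmorphism A -> B}) (a a' : A) (k : int) :
  f (zpow a a' k) = zpow (f a) (f a') k.
Proof. by case: k => m; rewrite /= rmorphXn. Qed.

Section ZpowScale.
Variables (K : fieldType) (X : Type) (r : fterm K X -> fterm K X -> Prop).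

Lemma zpowZ (l : K) (a a' : palg r) (k : int) : l != 0 ->
  zpow (l *: a) (l^-1 *: a') k = l ^ k *: zpow a a' k.
Proof.
move=> l0.
have XZ m (b : palg r) n : (m *: b) ^+ n = m ^+ n *: b ^+ n.
  elim: n => [|n IHn]; first by rewrite !expr0 scale1r.
  by rewrite !exprS IHn -palg_scaleAl -palg_scaleAr scalerA.
by case: k => m; rewrite /= XZ ?exprVn.
Qed.

Lemma qcomm_zpow (l : K) (a b b' : palg r) (k : int) : l != 0 -> inverses b b' ->
  qcomm l a b -> exists2 m, m != 0 & qcomm m a (zpow b b' k).
Proof.
move=> l0 bb' ab.
have pow m c n : qcomm m a c -> qcomm (m ^+ n) a (c ^+ n).
  move=> ac; elim: n => [|n IHn]; first by apply/qcomm1P; rewrite mulr1 mul1r.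
  by rewrite !exprS; exact: qcommMr ac IHn.
case: k => n; first by exists (l ^+ n); [rewrite expf_neq0|exact: pow].
exists (l^-1 ^+ n.+1); first by rewrite expf_neq0 // invr_eq0.
exact/pow/(qcommVr l0 bb' ab).
Qed.

End ZpowScale.

Lemma periodic_modz (V : Type) (f : int -> V) (m : nat) (n : int) :
  (forall n, f (n + m%:Z) = f n) -> f n = f (n %% m)%Z.
Proof.
move=> fP.
have fPn k j : f (j + k%:Z * m%:Z) = f j.
  elim: k => [|k IHk]; first by rewrite mul0r addr0.
  by rewrite -[RHS]IHk -[RHS]fP; congr f; rewrite -addn1 PoszD mulrDl mul1r addrA.
rewrite [in LHS](divz_eq n m) addrC; case: (n %/ m)%Z => k; first exact: fPn.
by rewrite -(fPn k.+1); congr f; rewrite NegzE mulNr -addrA addNr addr0.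
Qed.

(** * Spanning by Laurent monomials *)

Section Monomials.
Variables (K : fieldType) (N L : nat) (q : K).
Hypotheses (N0 : (0 < N)%N) (L0 : (0 < L)%N) (q0 : q != 0).

Local Notation C := (palg (Crel N L q)).
Local Notation chi := (chi N L q : int -> int -> C).

Definition chiV (i n : int) : C := ppi (Crel N L q) (FVar (ChiV i n)).

Lemma chi_inverses i n : inverses (chi i n) (chiV i n).
Proof.
by split; [have := ppi_rel (C_mulV N L q i n)|have := ppi_rel (C_Vmul N L q i n)];
  rewrite !ppiE.
Qed.

(** The case of odd n and even m is the defining relation of the swapped pair, inverted. *)
Lemma chi_qcomm i n j m : exists2 l : K, l != 0 & qcomm l (chi i n) (chi j m).
Proof.
have [o|e] := boolP (oddz (n - m)); last first.
  exists 1; first exact: oner_neq0.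
  by apply/qcomm1P; have := ppi_rel (C_comm N L q i j e); rewrite !ppiE.
have ev i' n' j' m' : ~~ oddz n' -> oddz m' ->
    exists2 l : K, l != 0 & qcomm l (chi i' n') (chi j' m').
  move=> e' o'; exists (q ^ Omega N L (i' - j') ((n' - m' - 1) %/ 2)%Z).
    by rewrite expfz_neq0.
  by have := ppi_rel (C_qcomm N L q i' j' e' o'); rewrite !ppiE.
have [on|en] := boolP (oddz n); last first.
  by apply: ev => //; move: o en; rewrite /oddz; lia.
have [|l l0 /(qcomm_sym l0) nm] := ev j m i n _ on; first by move: o on; rewrite /oddz; lia.
by exists l^-1; rewrite ?invr_eq0.
Qed.

Local Notation I := ('I_N * 'I_(2 * L))%type.
Local Notation chg j := (chi (j : I).1%:Z j.2%:Z).
Local Notation chgV j := (chiV (j : I).1%:Z j.2%:Z).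

Lemma chi_representative i n : exists j : I, chi i n = chg j /\ chiV i n = chgV j.
Proof.
have L20 : (0 < 2 * L)%N by rewrite muln_gt0.
have ltm m k : (0 < m)%N -> (`|(k %% m%:Z)%Z| < m)%N.
  move=> m0; rewrite -ltz_nat gez0_abs ?ltz_pmod // modz_ge0 //; lia.
have absm m k : (0 < m)%N -> Posz `|(k %% m%:Z)%Z| = (k %% m%:Z)%Z.
  by move=> m0; rewrite gez0_abs // modz_ge0 //; lia.
exists (Ordinal (ltm _ i N0), Ordinal (ltm _ n L20)); rewrite /= !absm //.
have chiE : chi i n = chi (i %% N)%Z (n %% (2 * L)%N)%Z.
  rewrite (@periodic_modz _ (fun i => chi i n) N i) => [|{}i]; last first.
    exact: (ppi_rel (C_perN N L q i n)).
  apply: (@periodic_modz _ (chi (i %% N)%Z)) => {}n.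
  exact: (ppi_rel (C_per2L N L q _ n)).
by split=> //; apply: inverses_inj (chi_inverses i n) _; rewrite chiE; exact: chi_inverses.
Qed.

(** The Laurent monomial with exponent vector b, its factors taken in the fixed enumeration of I
    because they need not commute. *)
Definition mono (b : {ffun I -> int}) : C := \prod_(j : I) zpow (chg j) (chgV j) (b j).

Lemma mono_inverses b : exists b', inverses (mono b) b'.
Proof.
rewrite /mono; elim/big_rec: _ => [|j x _ [x' xx']]; first by exists 1; exact: inverses1.
by eexists; apply: inversesM xx'; exact/zpow_inverses/chi_inverses.
Qed.

(* Only spanning is needed here, so the scalars l may be left unspecified. *)
Lemma mul_mono (g : C) (j : I) (e : int) (b : {ffun I -> int}) :
  (forall k, g * zpow (chg j) (chgV j) k = zpow (chg j) (chgV j) (k + e)) ->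
  (forall k m, exists l, qcomm l g (zpow (chg k) (chgV k) m)) ->
  exists l b', g * mono b = l *: mono b'.
Proof.
move=> gj gk; pose b' : {ffun I -> int} := [ffun k => if k == j then b k + e else b k].
suff [l gl] : exists l, g * mono b = l *: mono b' by exists l, b'.
rewrite /mono; have := index_enum_uniq I; have : j \in index_enum I by rewrite mem_index_enum.
(* Along the enumeration, g passes the factors before j at the cost of scalars and is absorbed at j;
   as j occurs only once, the later exponents are unchanged. *)
elim: (index_enum I) => // k s IHs; rewrite inE !big_cons /= ffunE.
case: eqVneq => [<- _ /andP[js _]|kj /= js /andP[_ us]].
  exists 1; rewrite scale1r mulrA gj; congr (_ * _).
  apply: eq_big_seq => m ms; rewrite ffunE; case: eqVneq => // mj.
  by rewrite -mj ms in js.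
have [l gl] := IHs js us; have [m gm] := gk k (b k).
by exists (m * l); rewrite mulrA gm -palg_scaleAl -mulrA gl -palg_scaleAr scalerA.
Qed.

Definition spanned (a : C) :=
  exists s : seq (K * {ffun I -> int}), a = \sum_(x <- s) x.1 *: mono x.2.

Lemma spannedD a a' : spanned a -> spanned a' -> spanned (a + a').
Proof. by move=> [s ->] [s' ->]; exists (s ++ s'); rewrite big_cat. Qed.

Lemma spannedZ k a : spanned a -> spanned (k *: a).
Proof.
move=> [s ->]; exists [seq (k * x.1, x.2) | x <- s].
by rewrite big_map scaler_sumr; apply: eq_bigr => x _; rewrite scalerA.
Qed.

Lemma spanned_mul_gen (g : C) a :
  (forall b, exists l b', g * mono b = l *: mono b') -> spanned a -> spanned (g * a).
Proof.
move=> gm [s ->]; elim: s => [|[k b] s IHs].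
  by exists [::]; rewrite !big_nil mulr0.
rewrite big_cons mulrDr; apply: spannedD IHs.
have [l [b' gb]] := gm b; exists [:: (k * l, b')].
by rewrite big_seq1 /= -palg_scaleAr gb scalerA.
Qed.

(** The span contains 1 and is stable under left multiplication by every generator. *)
Lemma all_spanned a : spanned a.
Proof.
have : spanned 1.
  exists [:: (1, [ffun => 0])]; rewrite big_seq1 scale1r /mono big1 // => j _.
  by rewrite ffunE.
(* The factor 1 is generalised to any spanned element, so that the induction on terms passes through
   products. *)
rewrite -[a in X in _ -> X]mulr1; move: (1 : C); rewrite -(ppi_surj a).
have qc i n k m : exists2 l, l != 0 & qcomm l (chi i n) (zpow (chg k) (chgV k) m).
  by have [l l0 ck] := chi_qcomm i n k.1 k.2; exact: qcomm_zpow (chi_inverses _ _) ck.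
elim: (repr a) => [[i n|i n]|||s IHs|s IHs t IHt|s IHs t IHt|k s IHs] c c_sp.
- apply: spanned_mul_gen c_sp => b.
  have [j [chij _]] := chi_representative i n.
  apply: (@mul_mono _ j 1) => [k|k m].
    by rewrite -/(chi i n) chij; exact/zpow_succ/chi_inverses.
  by have [l _ ?] := qc i n k m; exists l.
- apply: spanned_mul_gen c_sp => b.
  have [j [_ chij]] := chi_representative i n.
  apply: (@mul_mono _ j (- 1)) => [k|k m].
    by rewrite -/(chiV i n) chij; exact/zpow_pred/chi_inverses.
  have [l l0 ?] := qc i n k m; exists l^-1.
  exact: (qcommVl l0 (chi_inverses i n)).
- by rewrite ppi_zero mul0r -[0](scale0r c); exact: spannedZ.
- by rewrite ppi_one mul1r.
- by rewrite ppi_opp -scaleN1r -palg_scaleAl; exact/spannedZ/IHs.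
- by rewrite ppi_add mulrDl; apply: spannedD; [exact: IHs|exact: IHt].
- by rewrite ppi_mul -mulrA; exact/IHs/IHt.
- by rewrite ppi_scale -palg_scaleAl; exact/spannedZ/IHs.
Qed.

(** Terms with equal exponent vectors are collected, because independence concerns distinct
    monomials. *)
Lemma spanned_uniq a : exists (s : seq {ffun I -> int}) c,
  uniq s /\ a = \sum_(b <- s) c b *: mono b.
Proof.
have [s ->] := all_spanned a.
exists (undup [seq x.2 | x <- s]), (fun b => \sum_(x <- s | x.2 == b) x.1).
split; first exact: undup_uniq.
under [RHS]eq_bigr => b _ do rewrite scaler_suml big_mkcond.
rewrite exchange_big /=; apply: eq_big_seq => x xs.
rewrite (bigD1_seq x.2) ?undup_uniq ?mem_undup ?map_f //= eqxx big1 ?addr0 // => b.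
by rewrite eq_sym => /negPf ->.
Qed.

End Monomials.

(** * Independence of monomials through torus weights *)

Section Injectivity.
Variables (R : realType) (N L : nat) (q h : R[i]).
Hypotheses (N0 : (0 < N)%N) (L0 : (0 < L)%N) (q0 : q != 0).

Local Notation C := (palg (Crel N L q)).
Local Notation T := (palg (@Trel R N L h)).
Local Notation chi := (chi N L q : int -> int -> C).
Local Notation chiV := (chiV N L q : int -> int -> C).
Local Notation mono := (@mono _ N L q).
Local Notation eta := (eta N L h : int -> int -> T).

Variable iota : {rmorphism C -> T}.
Hypotheses (iotaZ : scalable iota) (iota_chi : forall i n, iota (chi i n) = - eta (n + i) i).

Let w : R[i] := cexp (- 2).

(** The torus morphism attached to j scales the image of the generator j by w and fixes that of
    every other one, so each monomial is an eigenvector whose eigenvalue records its exponent at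
    j. *)
Lemma torus_mono (j : 'I_N * 'I_(2 * L)) : exists f : {rmorphism T -> T},
  scalable f /\ forall b, f (iota (mono b)) = w ^ b j *: iota (mono b).
Proof.
have [f [fZ f_eta]] := torus_separates h N0 L0 j.1%:Z j.2%:Z.
exists f; split=> // b.
have w0 : w != 0 by exact: cexp_neq0.
pose c (k : 'I_N * 'I_(2 * L)) : R[i] := if k == j then w else 1.
have c0 k : c k != 0 by rewrite /c; case: ifP => _; rewrite ?oner_eq0.
have f_chi (k : 'I_N * 'I_(2 * L)) : f (iota (chi k.1%:Z k.2%:Z)) = c k *: iota (chi k.1%:Z k.2%:Z).
  rewrite iota_chi rmorphN /= f_eta scalerN; congr (- (_ *: _)); rewrite /c.
  congr (if _ then _ else _); case: k j {f_eta} @c c0 => [k1 k2] [j1 j2] /= _.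
  have ordE m (x y : 'I_m) : (m%:Z %| x%:Z - y%:Z)%Z = (x == y).
    by rewrite -eqz_mod_dvd !modz_small ?eqz_nat // lez_nat ltz_nat ltn_ord.
  by rewrite xpair_eqE !ordE andbC.
have f_chiV (k : 'I_N * 'I_(2 * L)) :
    f (iota (chiV k.1%:Z k.2%:Z)) = (c k)^-1 *: iota (chiV k.1%:Z k.2%:Z).
  apply: inverses_inj (inverses_morph f (inverses_morph iota (chi_inverses _ _ _ _ _))) _.
  have [aa' a'a] := inverses_morph iota (chi_inverses N L q k.1 k.2).
  by split; rewrite f_chi -palg_scaleAl -palg_scaleAr scalerA ?aa' ?a'a ?mulfV ?mulVf ?scale1r.
have -> : w ^ b j = \prod_k c k ^ b k.
  rewrite (bigD1 j) //= big1 ?mulr1 /c ?eqxx // => k /negPf ->.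
  by rewrite exp1rz.
rewrite /mono; elim: (index_enum _) => [|k s IHs].
  by rewrite !big_nil !rmorph1 scale1r.
rewrite !big_cons !rmorphM /= IHs !zpow_morph f_chi f_chiV zpowZ //.
by rewrite -palg_scaleAl -palg_scaleAr scalerA.
Qed.

Lemma mono_independent (s : seq {ffun 'I_N * 'I_(2 * L) -> int}) c :
  (1 : T) != 0 -> uniq s -> \sum_(b <- s) c b *: iota (mono b) = 0 ->
  forall b, b \in s -> c b = 0.
Proof.
move=> T0.
(* A monomial is a unit, so a nonzero scalar can annihilate its image only in a trivial algebra. *)
have mono_neq0 k b : k *: iota (mono b) = 0 -> k = 0.
  have [b' /(inverses_morph iota)[bb' _]] := mono_inverses q b.
  move=> /(congr1 (fun x => x * iota b')); rewrite -palg_scaleAl bb' mul0r => k1.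
  apply/eqP; apply: contraNT T0 => k0.
  by rewrite -[1](scale1r) -(mulVf k0) -scalerA k1 scaler0.
elim: s c => // b0 s IHs c /= /andP[b0s us]; rewrite big_cons => sum0.
have cs b : b \in s -> c b = 0.
  move=> bs; have [j bj] : exists j, b j != b0 j.
    apply/existsP; apply: contraR b0s; rewrite negb_exists => /forallP b_b0.
    by rewrite (_ : b0 = b) //; apply/ffunP => j; apply/esym/eqP; rewrite -[_ == _]negbK.
  (* Dedekind: subtract w^(b0 j) times the relation from its image under f,
     which removes the term of b0. *)
  have [f [fZ f_mono]] := torus_mono j.
  have : \sum_(b <- s) (c b * (w ^ b j - w ^ b0 j)) *: iota (mono b) = 0.
    have : f 0 - w ^ b0 j *: 0 = 0 by rewrite rmorph0 scaler0 subrr.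
    rewrite -{1 2}sum0 rmorphD /= fZ f_mono rmorph_sum /= scalerDr !scalerA.
    rewrite opprD addrACA [c b0 * _]mulrC subrr add0r scaler_sumr -sumrB => {2}<-.
    apply: eq_bigr => b' _; rewrite fZ f_mono !scalerA -scalerBl.
    by congr (_ *: _); ring.
  move/(IHs (fun b => c b * (w ^ b j - w ^ b0 j)) us)/(_ _ bs)/eqP.
  rewrite mulf_eq0 => /orP[/eqP //|]; rewrite subr_eq0 => /eqP/cexpN2_expz_inj.
  by move/eqP; rewrite (negPf bj).
move=> b; rewrite inE => /orP[/eqP ->|/cs //].
apply: (mono_neq0 _ b0); rewrite -[RHS]sum0 big_seq big1 ?addr0 // => b' /cs ->.
by rewrite scale0r.
Qed.

Lemma iota_injective a : (1 : T) != 0 -> iota a = 0 -> a = 0.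
Proof.
move=> T0; have [s [c [us ->]]] := spanned_uniq N0 L0 q0 a.
rewrite rmorph_sum /=; under eq_bigr => b _ do rewrite iotaZ.
move=> /(mono_independent T0 us) cs.
by rewrite big_seq big1 // => b /cs ->; rewrite scale0r.
Qed.

End Injectivity.

(** * Algebras of fractions and the exchange identity *)

Lemma trivial_ring (A : pzRingType) : (1 : A) = 0 -> forall a b : A, a = b.
Proof. by move=> A0 a b; rewrite -[a]mul1r -[b]mul1r A0 !mul0r. Qed.

Section AlgebraMaps.
Variables (K : fieldType) (X X' : Type).
Variables (r : fterm K X -> fterm K X -> Prop) (r' : fterm K X' -> fterm K X' -> Prop).
Variable f : palg r -> palg r'.
Hypothesis f_map : algebra_map f.

Lemma algebra_map0 : f 0 = 0.
Proof. by case: f_map => _ _ _ fZ; rewrite -[0](scale0r 0) fZ !scale0r. Qed.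

Lemma algebra_mapN a : f (- a) = - f a.
Proof. by case: f_map => _ _ _ fZ; rewrite -!scaleN1r fZ. Qed.

Lemma algebra_map_inverses a a' : inverses a a' -> inverses (f a) (f a').
Proof. by case: f_map => f1 _ fM _ [aa' a'a]; split; rewrite -fM ?aa' ?a'a f1. Qed.

Lemma algebra_map_qcomm l a b : qcomm l a b -> qcomm l (f a) (f b).
Proof. by case: f_map => _ _ fM fZ ab; rewrite /qcomm -!fM ab fZ. Qed.

Lemma algebra_map_trivial : (1 : palg r) = 0 -> (1 : palg r') = 0.
Proof. by case: f_map => f1 _ _ _ r0; rewrite -f1 r0 algebra_map0. Qed.

End AlgebraMaps.

Lemma algebra_map_comp (K : fieldType) X X' X'' r r' r''
    (f : @palg K X r -> @palg K X' r') (g : @palg K X' r' -> @palg K X'' r'') :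
  algebra_map f -> algebra_map g -> algebra_map (g \o f).
Proof.
move=> [f1 fD fM fZ] [g1 gD gM gZ]; split=> /= [|a b|a b|k a].
- by rewrite f1.
- by rewrite fD.
- by rewrite fM.
- by rewrite fZ.
Qed.

Section Fractions.
Variables (K : fieldType) (X : Type) (r : fterm K X -> fterm K X -> Prop).
Local Notation Fr := (palg (@frac_rel K X r)).
Local Notation frac_in := (@frac_in K X r : palg r -> Fr).

Lemma frac_in_map : algebra_map frac_in.
Proof.
split=> [|a b|a b|k a].
- exact: (ppi_rel (Frac_one r)).
- by have := ppi_rel (Frac_add a b); rewrite !ppiE.
- by have := ppi_rel (Frac_mul a b); rewrite !ppiE.
- by have := ppi_rel (Frac_scale k a); rewrite !ppiE.
Qed.

Lemma frac_inv_inverses (s : {a : palg r | a != 0}) :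
  inverses (frac_in (val s)) (ppi _ (FVar (FracInv s))).
Proof.
by split; [have := ppi_rel (Frac_mulV s)|have := ppi_rel (Frac_Vmul s)]; rewrite !ppiE.
Qed.

(** The generators of r determine both maps on [palg r], and uniqueness of inverses determines them
    on the adjoined inverses. *)
Lemma frac_map_ext X' (r' : fterm K X' -> fterm K X' -> Prop) (f f' : Fr -> palg r') :
  algebra_map f -> algebra_map f' ->
  (forall x, f (frac_in (ppi r (FVar x))) = f' (frac_in (ppi r (FVar x)))) -> f =1 f'.
Proof.
move=> fm fm' ff'.
have in_eq : f \o frac_in =1 f' \o frac_in.
  by apply: algebra_map_ext => //; apply: algebra_map_comp => //; exact: frac_in_map.
apply: algebra_map_ext => // -[a|s]; first exact: in_eq.
have inv_s := frac_inv_inverses s.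
apply: inverses_inj (algebra_map_inverses fm inv_s) _.
by rewrite (in_eq (val s) : f _ = f' _); have := algebra_map_inverses fm' inv_s.
Qed.

End Fractions.

(** By injectivity a nonzero element has nonzero image, which is invertible among the fractions of
    the target; its adjoined inverse is sent to that inverse. *)
Lemma frac_lift (K : fieldType) X X' (r : fterm K X -> fterm K X -> Prop)
    (r' : fterm K X' -> fterm K X' -> Prop) (f : palg r -> palg r') :
  algebra_map f -> ((1 : palg r') != 0 -> forall a, f a = 0 -> a = 0) ->
  exists F : {rmorphism palg (@frac_rel K X r) -> palg (@frac_rel K X' r')},
    scalable F /\ forall a, F (frac_in a) = frac_in (f a).
Proof.
move=> f_map f_inj; case: (f_map) => f1 fD fM fZ.
have [i1 iD iM iZ] := frac_in_map r'.
have f_unit (s : {a : palg r | a != 0}) :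
    inverses (frac_in (f (val s)) : palg (@frac_rel K X' r')) (pinv (frac_in (f (val s)))).
  (* Over a trivial target the fractions are trivial too, and any two elements there are mutually
     inverse. *)
  have [r0|r1] := eqVneq (1 : palg r') 0.
    have triv := trivial_ring (algebra_map_trivial (frac_in_map r') r0).
    by split; exact: triv.
  have fs0 : f (val s) != 0 by apply: contraNneq (valP s) => /(f_inj r1)/eqP.
  have inv_s := frac_inv_inverses (exist _ (f (val s)) fs0).
  by rewrite (pinvE inv_s).
pose g (x : frac_gen r) : palg (@frac_rel K X' r') :=
  match x with FracIn a => frac_in (f a) | FracInv s => pinv (frac_in (f (val s))) end.
have gr s t : frac_rel s t -> fterm_eval g s = fterm_eval g t.
  case=> [|a b|a b|k a|{}s|{}s] /=.
  - by rewrite f1 i1.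
  - by rewrite fD iD.
  - by rewrite fM iM.
  - by rewrite fZ iZ.
  - by case: (f_unit s).
  - by case: (f_unit s).
have [F [FZ Fg]] := palg_lift gr.
by exists F; split=> // a; rewrite /frac_in Fg.
Qed.

Lemma comm_inverses (A : pzRingType) (a b b' : A) :
  inverses b b' -> GRing.comm a b -> GRing.comm a b'.
Proof.
rewrite /GRing.comm => -[bb' b'b] ab.
by rewrite -[a in RHS]mulr1 -bb' (mulrA a) ab !mulrA b'b mul1r.
Qed.

(* kappa_core without the coordinates: the index m or p stands for the point to
   the left or right of (X, Y), or, after s, below or above it; A and B are its
   horizontal and vertical pairs, u and v the denominators and numerators. *)
Lemma exchange_identity (K : fieldType) X (r : fterm K X -> fterm K X -> Prop)
    (Am Ap Bm Bp tm tm' tp tp' sm sm' sp sp' um Um up Up vm vp : palg r) (k l m : K) :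
  m != 0 ->
  inverses tm tm' -> inverses tp tp' -> inverses sm sm' -> inverses sp sp' ->
  inverses um Um -> inverses up Up ->
  Bm * Bp = Am * Ap -> qcomm l Bp tm -> qcomm m Ap sm -> k * l = m ->
  GRing.comm um Bp -> GRing.comm um tp -> GRing.comm um vm -> GRing.comm um vp ->
  GRing.comm up vm ->
  GRing.comm vm Bm -> GRing.comm vm Bp -> GRing.comm vm tm -> GRing.comm vm tp ->
  GRing.comm vm Am ->
  GRing.comm vp Bm -> GRing.comm vp Bp -> GRing.comm vp tm -> GRing.comm vp tp ->
  GRing.comm vp Am -> GRing.comm vp Ap -> GRing.comm vp sm ->
  GRing.comm sp sm -> GRing.comm sm tm -> GRing.comm sm tp -> GRing.comm sp tm ->
  GRing.comm sp tp -> GRing.comm tm tp ->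
  Bm * tm' * um * (Bp * tp' * up)
    * (k *: (vm * Up * (vp * Um) * (sp' * (sm' * (tm * tp)))))
  = Am * vm * sm' * (Ap * vp * sp').
Proof.
move=> m0 itm itp ism isp ium iup BA Bptm Apsm klm.
move=> uB ut uvm uvp upvm vmBm vmBp vmtm vmtp vmA vpBm vpBp vptm vptp vpAm vpAp vpsm.
move=> ssc smtm smtp sptm sptp ttc.
have ex (a b : palg r) : GRing.comm a b -> forall z, a * (b * z) = b * (a * z).
  by move=> ab z; rewrite !mulrA ab.
have V (a b b' : palg r) := @comm_inverses _ a b b'.
have evens : sp' * (sm' * (tm * tp)) = tp * (tm * (sm' * sp')).
  have c1 : GRing.comm sm' tm by apply/commr_sym/(V _ _ _ ism)/commr_sym.
  have c2 : GRing.comm sm' tp by apply/commr_sym/(V _ _ _ ism)/commr_sym.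
  have c3 : GRing.comm sp' tm by apply/commr_sym/(V _ _ _ isp)/commr_sym.
  have c4 : GRing.comm sp' tp by apply/commr_sym/(V _ _ _ isp)/commr_sym.
  have c5 : GRing.comm sp' sm'.
    by apply: (V _ _ _ ism); apply/commr_sym/(V _ _ _ isp)/commr_sym.
  by rewrite (ex _ _ c5) (ex _ _ c3) c4 (ex _ _ ttc) (ex _ _ c2) (ex _ _ c1).
(* um and up cancel against Um and Up, and tp' against tp; vm and vp commute with the factors in
   their way and come to the front. *)
have lhs : Bm * tm' * um * (Bp * tp' * up) * (vm * Up * (vp * Um) * (sp' * (sm' * (tm * tp))))
    = vm * (vp * (Bm * (tm' * (Bp * (tm * (sm' * sp')))))).
  rewrite evens -!mulrA (ex _ _ uB) (ex _ _ (V _ _ _ itp ut)) (ex _ _ upvm).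
  have -> z : up * (Up * z) = z by rewrite mulrA; case: iup => ->; rewrite mul1r.
  rewrite (ex _ _ uvm) (ex _ _ uvp).
  have -> z : um * (Um * z) = z by rewrite mulrA; case: ium => ->; rewrite mul1r.
  have vmtm' := V _ _ _ itm vmtm; have vmtp' := V _ _ _ itp vmtp.
  have vptm' := V _ _ _ itm vptm; have vptp' := V _ _ _ itp vptp.
  rewrite -(ex _ _ vmtp') -(ex _ _ vmBp) -(ex _ _ vmtm') -(ex _ _ vmBm).
  rewrite -(ex _ _ vptp') -(ex _ _ vpBp) -(ex _ _ vptm') -(ex _ _ vpBm).
  by have -> z : tp' * (tp * z) = z by rewrite mulrA; case: itp => _ ->; rewrite mul1r.
(* Here moving sm' to the right past Ap costs m. *)
have rhs : Am * vm * sm' * (Ap * vp * sp') = m *: (vm * (vp * (Am * (Ap * (sm' * sp'))))).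
  rewrite -!mulrA -(ex _ _ vpAp).
  rewrite -(ex _ _ (V _ _ _ ism vpsm)) -(ex _ _ vmA) -(ex _ _ vpAm).
  have Apsm' : qcomm m sm' Ap.
    by rewrite -[m]invrK; apply: qcomm_sym; [rewrite invr_eq0|exact: qcommVr Apsm].
  by rewrite (mulrA sm') Apsm' -!(palg_scaleAl, palg_scaleAr) -!mulrA.
(* Moving tm to the left past Bp costs l, and k l = m balances the scalars; Bm Bp = Am Ap settles
   the rest. *)
rewrite -palg_scaleAr lhs rhs (mulrA Bp) Bptm -!(palg_scaleAl, palg_scaleAr) scalerA klm.
rewrite -(mulrA tm).
have -> z : tm' * (tm * z) = z by rewrite mulrA; case: itm => _ ->; rewrite mul1r.
by rewrite (mulrA Bm) BA -mulrA.
Qed.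

(** * The exchange identity on the lattice *)

Section KappaCore.
Variables (R : realType) (N L : nat) (q h : R[i]).
Hypotheses (N1 : (1 < N)%N) (L1 : (1 < L)%N) (q0 : q != 0) (hq : cexp h = q).

Local Notation T := (palg (@Trel R N L h)).
Local Notation W := (palg (@frac_rel _ _ (@Trel R N L h))).
Local Notation inW := (@frac_in _ _ (@Trel R N L h) : T -> W).
Local Notation t x y := (inW (tau N L h x y)).
Local Notation t' x y := (inW (tauV N L h x y)).
Local Notation e x y := (inW (eta N L h x y)).
Local Notation e' x y := (inW (etaV N L h x y)).

Let N0 : (0 < N)%N := ltnW N1.
Let L0 : (0 < L)%N := ltnW L1.
Let inW_map : algebra_map inW := frac_in_map _.

Let t_inv x y : inverses (t x y) (t' x y).
Proof. exact: (algebra_map_inverses inW_map (tau_inverses N L h x y)). Qed.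

Let e_inv x y : inverses (e x y) (e' x y).
Proof. exact: (algebra_map_inverses inW_map (eta_inverses N L h x y)). Qed.

Let tt x y x1 y1 : oddz (x + y) = oddz (x1 + y1) -> GRing.comm (t x y) (t x1 y1).
Proof.
by move=> par; apply/qcomm1P; exact: (algebra_map_qcomm inW_map (tau_comm N L h par)).
Qed.

Let te x y x1 y1 : oddz (x + y) != oddz (x1 + y1) -> GRing.comm (t x y) (e x1 y1).
Proof.
by move=> par; apply/qcomm1P; exact: (algebra_map_qcomm inW_map (tau_eta_comm N L h par)).
Qed.

Let ee x y x1 y1 : oddz (x + y) = oddz (x1 + y1) -> GRing.comm (e x y) (e x1 y1).
Proof.
by move=> par; apply/qcomm1P; exact: (algebra_map_qcomm inW_map (eta_comm N L h par)).
Qed.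

Let et x y x1 y1 : ~~ oddz (x + y) -> ~~ oddz (x1 + y1) ->
  qcomm (q ^ lap N L (x - x1) (y - y1)) (e x y) (t x1 y1).
Proof.
move=> ev ev1; apply: (algebra_map_qcomm inW_map).
exact: eta_tau_qcomm.
Qed.

Let et0 x y x1 y1 : ~~ oddz (x + y) -> ~~ oddz (x1 + y1) ->
  lap N L (x - x1) (y - y1) = 0 -> GRing.comm (e x y) (t x1 y1).
Proof. by move=> ev ev1 l0; apply/qcomm1P; have := et ev ev1; rewrite l0 expr0z. Qed.

(* kappat sends tau(x - s, y) to - (hpair + vpair) tau(x, y)^-1, and
   eta = hpair^-1 vpair; kden and knum are the images of the binomials in the
   denominators and numerators of kappa. *)
Definition hpair x y : W := t (x + 1) y * t (x - 1) y.
Definition vpair x y : W := t x (y + 1) * t x (y - 1).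
Definition kden x y : W := 1 + q ^- 2 *: e' x y.
Definition knum x y : W := 1 + e x y.

Lemma hpair_eta x y : hpair x y * e x y = vpair x y.
Proof.
case: inW_map => i1 _ iM _.
rewrite eta_tau !iM /hpair /vpair -!mulrA.
have c : GRing.comm (t (x + 1) y) (t (x - 1) y) by apply: tt; rewrite /oddz; lia.
have -> z : t (x - 1) y * (t' (x + 1) y * z) = t' (x + 1) y * (t (x - 1) y * z).
  by rewrite !mulrA; congr (_ * _); exact/(comm_inverses (t_inv _ _))/commr_sym.
have K x1 y1 z : t x1 y1 * (t' x1 y1 * z) = z by rewrite mulrA (t_inv x1 y1).1 mul1r.
by rewrite !K; apply: tt; rewrite /oddz; lia.
Qed.

Lemma vpair_etaV x y : vpair x y * e' x y = hpair x y.
Proof. by rewrite -hpair_eta -mulrA (e_inv x y).1 mulr1. Qed.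

Lemma lap_origin : lap N L 0 0 = - 2.
Proof. by rewrite /lap /delta !dvdz0. Qed.

(** The horizontal pair is the vertical pair times the inverse of eta. Bringing that inverse past
    the inverse of tau at the same point costs q^(-2), since [lap] is -2 at the origin; this is the
    factor in [kden]. *)
Lemma vpair_kden x y : ~~ oddz (x + y) ->
  (hpair x y + vpair x y) * t' x y = vpair x y * t' x y * kden x y.
Proof.
move=> ev; rewrite -(vpair_etaV x y) -{2}[vpair x y]mulr1 -mulrDr -2!mulrA.
have := et ev ev; rewrite !subrr lap_origin => /(qcommVl _ (e_inv x y)).
rewrite expfz_neq0 // => /(_ isT) /(qcommVr _ (t_inv x y)).
rewrite invr_eq0 expfz_neq0 // => /(_ isT).
rewrite invrK /qcomm => et'; congr (_ * _); rewrite /kden mulrDl mul1r [RHS]mulrDr mulr1 addrC.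
by rewrite et' palg_scaleAr.
Qed.

Lemma hpair_knum x y : (hpair x y + vpair x y) * t' x y = hpair x y * knum x y * t' x y.
Proof. by rewrite /knum mulrDr mulr1 hpair_eta. Qed.

Lemma G_balance : G N L 1 2 + G N L (- 1) 2 = - 2 + (G N L 2 1 + G N L 2 (- 1)).
Proof.
have h0 : G N L 0 (- 1) + G N L 0 1 - G N L (- 1) 0 - G N L 1 0 = - 2.
  by have := @G_laplacian N L 0 0 N0 L0 isT; rewrite /delta !dvdz0.
(* At (1, 1) and (-1, 1) the delta vanishes because N > 1. *)
have h1 : G N L 1 0 + G N L 1 2 - G N L 0 1 - G N L 2 1 = 0.
  by have := @G_laplacian N L 1 1 N0 L0 isT; rewrite (@delta_unit N 1) // !mulr0.
have h2 : G N L (- 1) 0 + G N L (- 1) 2 - G N L (- 2) 1 - G N L 0 1 = 0.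
  by have := @G_laplacian N L (- 1) 1 N0 L0 isT; rewrite (@delta_unit N 1) // !mulr0.
have e1 : G N L 0 (- 1) = G N L 0 1 := @G_even N L 0 1 N0 L0 isT.
have e2 : G N L (- 2) 1 = G N L 2 (- 1) := @G_even N L 2 (- 1) N0 L0 isT.
move: h0 h1 h2; rewrite e1 e2.
lra.
Qed.

Lemma commZ a (k : R[i]) (b : W) : GRing.comm a b -> GRing.comm a (k *: b).
Proof. by rewrite /GRing.comm -palg_scaleAr -palg_scaleAl => ->. Qed.

Lemma comm_kden a x y : GRing.comm a (e x y) -> GRing.comm a (kden x y).
Proof.
move=> ae; apply: commrD (commr1 _) (commZ _ _).
exact: comm_inverses (e_inv x y) ae.
Qed.

Lemma comm_knum a x y : GRing.comm a (e x y) -> GRing.comm a (knum x y).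
Proof. by move=> ae; exact: commrD (commr1 _) ae. Qed.

Lemma comm_hpair_eta x y x1 y1 : oddz (x + y) = oddz (x1 + y1) -> GRing.comm (hpair x y) (e x1 y1).
Proof.
by move=> par; apply/commr_sym/commrM; apply/commr_sym/te; move: par; rewrite /oddz; lia.
Qed.

Lemma comm_vpair_eta x y x1 y1 : oddz (x + y) = oddz (x1 + y1) -> GRing.comm (vpair x y) (e x1 y1).
Proof.
by move=> par; apply/commr_sym/commrM; apply/commr_sym/te; move: par; rewrite /oddz; lia.
Qed.

(** The images of the horizontal tau's times the image of the kappa formula give the images of the
    vertical ones. Vertical pairs are factored out at the horizontal neighbours and horizontal pairs
    at the vertical neighbours, so both sides carry the tau's at the same four corners around (X,
    Y). *)
Lemma kappa_core X Y Um Up : oddz (X + Y) ->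
  inverses (kden (X - 1) Y) Um -> inverses (kden (X + 1) Y) Up ->
  (hpair (X - 1) Y + vpair (X - 1) Y) * t' (X - 1) Y
    * ((hpair (X + 1) Y + vpair (X + 1) Y) * t' (X + 1) Y)
    * (q ^- 2 *: (knum X (Y - 1) * Up * (knum X (Y + 1) * Um) * e' X Y))
  = (hpair X (Y - 1) + vpair X (Y - 1)) * t' X (Y - 1)
    * ((hpair X (Y + 1) + vpair X (Y + 1)) * t' X (Y + 1)).
Proof.
move=> o iUm iUp.
have om : ~~ oddz (X - 1 + Y) by move: o; rewrite /oddz; lia.
have op : ~~ oddz (X + 1 + Y) by move: o; rewrite /oddz; lia.
have osm : ~~ oddz (X + (Y - 1)) by move: o; rewrite /oddz; lia.
have osp : ~~ oddz (X + (Y + 1)) by move: o; rewrite /oddz; lia.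
have par a b c d : ~~ oddz (a + b) -> ~~ oddz (c + d) -> oddz (a + b) = oddz (c + d).
  by move=> /negPf -> /negPf ->.
(* L > 1 makes the eta at a neighbour of (X, Y) commute with the tau at the opposite neighbour; N >
   1 does this for neighbours that differ by a diagonal step. *)
have lapL x y : `|((x - y) %/ 2)%Z|%N = 1%N -> lap N L x y = 0.
  by move=> xy; rewrite /lap (delta_unit L1 xy) mul0r mulr0.
have lapN x y : `|y|%N = 1%N -> lap N L x y = 0.
  by move=> y1; rewrite /lap (delta_unit N1 y1) !mulr0.
rewrite (vpair_kden om) (vpair_kden op) !hpair_knum.
pose E g : R[i] := cexp (h * ratr g).
have ED g g' : E (g + g') = E g * E g' by rewrite /E rmorphD mulrDr cexpD.
have ttq x y x1 y1 dx dy : x - x1 = dx -> y - y1 = dy ->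
    oddz (x + y) -> ~~ oddz (x1 + y1) -> qcomm (E (G N L dx dy)) (t x y) (t x1 y1).
  by move=> <- <- o1 e1; apply: (algebra_map_qcomm inW_map); exact: tau_qcomm.
have -> : e' X Y = t' X (Y + 1) * (t' X (Y - 1) * (t (X - 1) Y * t (X + 1) Y)).
  by case: inW_map => _ _ iM _; rewrite /etaV !iM.
(* The scalar l is the cost of passing the right vertical pair over tau(X - 1, Y), and m that of
   passing the upper horizontal pair over tau(X, Y - 1); by [G_balance] their ratio m/l is
   q^(-2). *)
apply: (@exchange_identity _ _ _ _ _ _ _ _ _ _ _ (t X (Y - 1)) _ (t X (Y + 1)) _ _ _ _ _ _ _ _
  (E (G N L 2 1 + G N L 2 (- 1))) (E (G N L 1 2 + G N L (- 1) 2)));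
  try exact: t_inv; try exact: iUm; try exact: iUp;
  try (apply: tt; exact: par).
- exact: cexp_neq0.
- rewrite /vpair /hpair.
  set a := t (X - 1) (Y + 1); set b := t (X - 1) (Y - 1).
  set c := t (X + 1) (Y + 1); set d := t (X + 1) (Y - 1).
  have [ab ac ad] : [/\ GRing.comm a b, GRing.comm a c & GRing.comm a d].
    by split; apply: tt; rewrite /oddz; lia.
  have [bd cd] : GRing.comm b d /\ GRing.comm c d.
    by split; apply: tt; rewrite /oddz; lia.
  rewrite -mulrA (commrM ab (commrM ac ad)) cd (mulrA b) bd.
  by rewrite -!mulrA.
- by rewrite ED; apply: qcommMl; apply: ttq; rewrite ?/oddz; move: o; rewrite /oddz; lia.
- by rewrite ED; apply: qcommMl; apply: ttq; rewrite ?/oddz; move: o; rewrite /oddz; lia.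
- rewrite G_balance [RHS]ED; congr (_ * _).
  rewrite /E; have -> : (- 2 : rat) = (- 2%:Z)%:~R by rewrite rmorphN.
  by rewrite ratr_int cexp_int hq.
- exact/commr_sym/comm_kden/comm_vpair_eta/par.
- by apply/commr_sym/comm_kden/commr_sym/et0 => //; apply: lapL; lia.
- by apply/comm_knum/commr_sym/comm_kden/ee/par.
- by apply/comm_knum/commr_sym/comm_kden/ee/par.
- by apply/comm_knum/commr_sym/comm_kden/ee/par.
- exact/commr_sym/comm_knum/comm_vpair_eta/par.
- exact/commr_sym/comm_knum/comm_vpair_eta/par.
- by apply/commr_sym/comm_knum/commr_sym/et0 => //; apply: lapN; lia.
- by apply/commr_sym/comm_knum/commr_sym/et0 => //; apply: lapN; lia.
- exact/commr_sym/comm_knum/comm_hpair_eta/par.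
- exact/commr_sym/comm_knum/comm_vpair_eta/par.
- exact/commr_sym/comm_knum/comm_vpair_eta/par.
- by apply/commr_sym/comm_knum/commr_sym/et0 => //; apply: lapN; lia.
- by apply/commr_sym/comm_knum/commr_sym/et0 => //; apply: lapN; lia.
- exact/commr_sym/comm_knum/comm_hpair_eta/par.
- exact/commr_sym/comm_knum/comm_hpair_eta/par.
- by apply/commr_sym/comm_knum/commr_sym/et0 => //; apply: lapL; lia.
Qed.

End KappaCore.

(** * Intertwining *)

Section Kappa.
Variables (R : realType) (N L : nat) (q h : R[i]).
Hypotheses (N1 : (1 < N)%N) (L1 : (1 < L)%N) (q0 : q != 0) (hq : cexp h = q).

Local Notation C := (palg (Crel N L q)).
Local Notation T := (palg (@Trel R N L h)).
Local Notation FC := (palg (@frac_rel _ _ (Crel N L q))).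
Local Notation FT := (palg (@frac_rel _ _ (@Trel R N L h))).
Local Notation inC := (@frac_in _ _ (Crel N L q) : C -> FC).
Local Notation inT := (@frac_in _ _ (@Trel R N L h) : T -> FT).
Local Notation tau := (tau N L h : int -> int -> T).
Local Notation eta := (eta N L h : int -> int -> T).
Local Notation x_ i n := (inC (chi N L q i n)).
Local Notation t_ x y := (inT (tau x y)).

Variables (iota : C -> T) (F : {rmorphism FC -> FT}).
Hypotheses (iota_map : algebra_map iota) (FZ : scalable F).
Hypothesis iota_chi : forall i n, iota (chi N L q i n) = - eta (n + i) i.
Hypothesis F_in : forall a, F (inC a) = inT (iota a).

Lemma pinv_tau x y : pinv (t_ x y) = inT (tauV N L h x y).
Proof. exact: pinvE (algebra_map_inverses (frac_in_map _) (tau_inverses _ _ _ _ _)). Qed.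

Lemma F_chi i n : F (x_ i n) = - inT (eta (n + i) i).
Proof. by rewrite F_in iota_chi (algebra_mapN (frac_in_map _)). Qed.

Lemma eta_in_inverses x y : inverses (inT (eta x y)) (inT (etaV N L h x y)).
Proof. exact: (algebra_map_inverses (frac_in_map _) (eta_inverses _ _ _ _ _)). Qed.

Lemma x_inverses i n : inverses (x_ i n) (pinv (x_ i n)).
Proof.
have xi := algebra_map_inverses (frac_in_map _) (chi_inverses N L q i n).
by rewrite (pinvE xi).
Qed.

Lemma F_pinv_chi i n : F (pinv (x_ i n)) = - inT (etaV N L h (n + i) i).
Proof.
apply: inverses_inj (inverses_morph F (x_inverses i n)) _.
by rewrite F_chi; apply/inversesN/eta_in_inverses.
Qed.

(** The shift s enters only through the points at which the formulas are read, so one argument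
    serves both signs. *)
Lemma kappa_intertwined (s : int) (k : {rmorphism FC -> FC}) (kt : {rmorphism FT -> FT}) :
  scalable k -> scalable kt ->
  (forall i n, ~~ oddz n -> k (x_ i (n - s)) = x_ i n) ->
  (forall i n, oddz n ->
     k (x_ i (n - s)) =
       q ^- 2 *: ((1 - x_ (i - 1) (n + 1)) * pinv (1 - q ^- 2 *: pinv (x_ i (n + 1)))
                * ((1 - x_ (i + 1) (n - 1)) * pinv (1 - q ^- 2 *: pinv (x_ i (n - 1))))
                * pinv (x_ i n))) ->
  (forall x y, oddz (x + y) -> kt (t_ (x - s) y) = t_ x y) ->
  (forall x y, ~~ oddz (x + y) ->
     kt (t_ (x - s) y) =
       - ((t_ (x + 1) y * t_ (x - 1) y + t_ x (y + 1) * t_ x (y - 1)) * pinv (t_ x y))) ->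
  F \o k =1 kt \o F.
Proof.
move=> kZ ktZ k_even k_odd kt_odd kt_even.
have [i1 iD iM iZ] := frac_in_map (@Trel R N L h).
have kt_tauV x y : inverses (kt (t_ x y)) (kt (inT (tauV N L h x y))).
  by apply/inverses_morph/(algebra_map_inverses (frac_in_map _))/tau_inverses.
have kt_eta x y : kt (inT (eta (x - s) y)) =
    kt (inT (tauV N L h (x + 1 - s) y)) * kt (inT (tauV N L h (x - 1 - s) y))
    * kt (t_ (x - s) (y - 1)) * kt (t_ (x - s) (y + 1)).
  by rewrite eta_tau !iM !rmorphM /= !(addrAC x _ (- s)).
have F_map := algebra_map_rmorphism FZ.
apply: frac_map_ext.
- exact: algebra_map_comp (algebra_map_rmorphism kZ) F_map.
- exact: algebra_map_comp F_map (algebra_map_rmorphism ktZ).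
(* The inverse generators follow from the chi's by uniqueness of inverses. *)
suff main i n : F (k (x_ i n)) = kt (F (x_ i n)).
  case=> i n; first exact: main.
  have Fk_inv := inverses_morph F (inverses_morph k (x_inverses i n)).
  have ktF_inv := inverses_morph kt (inverses_morph F (x_inverses i n)).
  have -> : frac_in (ppi (Crel N L q) (FVar (ChiV i n))) = pinv (x_ i n).
    apply: inverses_inj _ (x_inverses i n).
    exact: (algebra_map_inverses (frac_in_map _) (chi_inverses N L q i n)).
  by rewrite main in Fk_inv; exact: inverses_inj Fk_inv ktF_inv.
have -> : n = n + s - s by ring.
move: (n + s) => {}n; rewrite F_chi rmorphN addrAC kt_eta.
have [o|e] := boolP (oddz n); last first.
  (* For even n all four tau's in eta(n + i, i) have odd coordinate sum, so kt only translates
     them. *)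
  rewrite k_even // F_chi; congr (- _); rewrite eta_tau !iM.
  have kt_V x y : oddz (x + y) -> kt (inT (tauV N L h (x - s) y)) = inT (tauV N L h x y).
    move=> o; have := kt_tauV (x - s) y; rewrite kt_odd // => /inverses_inj; apply.
    exact: (algebra_map_inverses (frac_in_map _) (tau_inverses _ _ _ _ _)).
  rewrite !kt_V ?kt_odd //; by move: e; rewrite /oddz; lia.
have Xo : oddz (n + i + i) by move: o; rewrite /oddz; lia.
(* If pinv took its junk value 0, then k would send the unit x_ i (n - s) to 0,
   and all the fraction algebras would be trivial. *)
have [|p1] := pinvP (1 - q ^- 2 *: pinv (x_ i (n + 1))); last first.
  have := inverses_morph k (x_inverses i (n - s)); rewrite k_odd // p1.
  rewrite mulr0 !mul0r scaler0 => -[]; rewrite mul0r => /esym C0 _.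
  exact/trivial_ring/(algebra_map_trivial F_map C0).
have [|p2] := pinvP (1 - q ^- 2 *: pinv (x_ i (n - 1))); last first.
  have := inverses_morph k (x_inverses i (n - s)); rewrite k_odd // p2.
  rewrite !mulr0 !mul0r scaler0 => -[]; rewrite mul0r => /esym C0 _ _.
  exact/trivial_ring/(algebra_map_trivial F_map C0).
move=> /(inverses_morph F) im /(inverses_morph F) ip.
have F_u m : F (1 - q ^- 2 *: pinv (x_ i m)) = kden N L q h (m + i) i.
  by rewrite rmorphB rmorph1 /= FZ F_pinv_chi scalerN opprK.
have F_v j m : F (1 - x_ j m) = knum N L h (m + j) j.
  by rewrite rmorphB rmorph1 /= F_chi opprK.
rewrite k_odd // FZ !rmorphM /= !F_v F_pinv_chi.
rewrite !F_u in im ip.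
have -> : n + 1 + (i - 1) = n + i by ring.
have -> : n - 1 + (i + 1) = n + i by ring.
rewrite (addrAC n 1) in ip; rewrite (addrAC n (- 1)) in im.
have core := kappa_core N1 L1 q0 hq Xo im ip.
rewrite mulrN scalerN; congr (- _).
have M x y : ~~ oddz (x + y) -> kt (t_ (x - s) y) =
    - ((hpair N L h x y + vpair N L h x y) * inT (tauV N L h x y)).
  by move=> e; rewrite kt_even // pinv_tau.
have Mm : ~~ oddz (n + i - 1 + i) by move: Xo; rewrite /oddz; lia.
have Mp : ~~ oddz (n + i + 1 + i) by move: Xo; rewrite /oddz; lia.
(* The signs from kt cancel in pairs. After [kappa_core] replaces the product of the vertical
   images, the horizontal images cancel against their inverses. *)
rewrite -[RHS]mulrA !(M (n + i)); try (by move: Xo; rewrite /oddz; lia).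
rewrite mulrNN -core [RHS]mulrA.
have := inversesM (kt_tauV (n + i - 1 - s) i) (kt_tauV (n + i + 1 - s) i).
rewrite !M // mulrNN => -[_ ->].
by rewrite mul1r.
Qed.

End Kappa.

Theorem proposition11 (R : realType) (N L : nat) (q h : R[i]) :
  (0 < N)%N -> (0 < L)%N -> q != 0 -> cexp h = q ->
  exists iota : {rmorphism Cq N L q -> Tq N L h},
  [/\ scalable iota,
      forall i n : int, iota (chi N L q i n) = - eta N L h (n + i) i &
      exists iotaF : {rmorphism fracC N L q -> fracT N L h},
      [/\ scalable iotaF,
          forall a, iotaF (CinF a) = TinF (iota a) &
          (1 < N)%N -> (1 < L)%N ->
          forall (kp km : {rmorphism fracC N L q -> fracC N L q})
                 (ktp ktm : {rmorphism fracT N L h -> fracT N L h}),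
          [/\ scalable kp, bijective kp & kappa_formulas 1 kp] ->
          [/\ scalable km, bijective km & kappa_formulas (-1) km] ->
          [/\ scalable ktp, bijective ktp & kappat_formulas 1 ktp] ->
          [/\ scalable ktm, bijective ktm & kappat_formulas (-1) ktm] ->
          iotaF \o kp =1 ktp \o iotaF /\ iotaF \o km =1 ktm \o iotaF]].
Proof.
move=> N0 L0 q0 hq.
have [iota [iotaZ iota_chi _]] := iota_exists N0 L0 q0 hq.
have iota_map := algebra_map_rmorphism iotaZ.
have [F [FZ F_in]] := frac_lift iota_map (fun T1 a => iota_injective N0 L0 q0 iotaZ iota_chi T1).
exists iota; split=> //; exists F; split=> // N1 L1 kp km ktp ktm.
move=> [kpZ _ [kp_e kp_o]] [kmZ _ [km_e km_o]] [ktpZ _ [ktp_o ktp_e]] [ktmZ _ [ktm_o ktm_e]].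
split.
  exact: (kappa_intertwined N1 L1 q0 hq FZ iota_chi F_in kpZ ktpZ kp_e kp_o ktp_o ktp_e).
exact: (kappa_intertwined N1 L1 q0 hq FZ iota_chi F_in kmZ ktmZ km_e km_o ktm_o ktm_e).
Qed.
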